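(* Let $d=2k$ be an even positive integer. Then in $\mathbb{R}^d$ there are, up to affine similarity, exactly three isotropic 2-attractors: a parallelepiped, a direct product of $k$ dragons, and a direct product of $k$ bears. That is, each of these three types is (up to affine similarity) an isotropic 2-attractor, the three types are pairwise not affinely similar, and every isotropic 2-attractor in $\mathbb{R}^d$ is affinely similar to one of them.
   Context: An integer $d\times d$ matrix $M$ is called expanding if all its (complex) eigenvalues have modulus strictly greater than $1$. Let $M$ be an integer expanding $d\times d$ matrix with $|\det M|=2$ and let $D=\{\boldsymbol d_0,\boldsymbol d_1\}\subset\mathbb{Z}^d$ with $\boldsymbol d_1-\boldsymbol d_0\notin M\mathbb{Z}^d$. The 2-attractor generated by $M$ and $D$ is the compact set $G(M,D)=\{\sum_{j=1}^{\infty}M^{-j}\boldsymbol a_j : \boldsymbol a_j\in D \text{ for all } j\}\subset\mathbb{R}^d$. A matrix is isotropic if it is diagonalizable over $\mathbb{C}$ and all its eigenvalues have the same modulus. A 2-attractor is isotropic if it is generated by an isotropic matrix $M$. Two subsets of $\mathbb{R}^d$ are affinely similar if one is the image of the other under an invertible affine map of $\mathbb{R}^d$. A parallelepiped is a set affinely similar to $[0,1]^d$. A dragon is a subset of $\mathbb{R}^2$ affinely similar to a 2-attractor $G(M,D)\subset\mathbb{R}^2$ where $M$ has characteristic polynomial $z^2-2z+2$ or $z^2+2z+2$; a bear is a subset of $\mathbb{R}^2$ affinely similar to a 2-attractor $G(M,D)\subset\mathbb{R}^2$ where $M$ has characteristic polynomial $z^2-z+2$ or $z^2+z+2$ (in each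 case the set is unique up to affine similarity). A direct product of $k$ dragons (bears) is the set $K_1\times\cdots\times K_k\subset(\mathbb{R}^2)^k=\mathbb{R}^{2k}$ where each $K_i$ is a dragon (respectively, each $K_i$ is a bear). *)

(* Defs.v *)
(* MathComp / MathComp-Analysis *)
From HB Require Import structures.
From mathcomp Require Import all_boot all_order all_algebra.
From mathcomp Require Import all_classical all_reals all_analysis.
From mathcomp Require Import complex.

Set Implicit Arguments.
Unset Strict Implicit.
Unset Printing Implicit Defensive.

Import Order.TTheory GRing.Theory Num.Theory.
Import numFieldNormedType.Exports.

Local Open Scope classical_set_scope.
Local Open Scope ring_scope.

(* Points of R^d and digits of Z^d are column vectors. *)

Definition expanding (R : realType) (d : nat) (M : 'M[int]_d) : Prop :=
  forall z : R[i], eigenvalue (map_mx intr M) z -> 1 < `|z|.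

Definition isotropic (R : realType) (d : nat) (M : 'M[int]_d) : Prop :=
  let MC : 'M[R[i]]_d := map_mx intr M in
  diagonalizable MC /\
  forall z w : R[i], eigenvalue MC z -> eigenvalue MC w -> `|z| = `|w|.

(* The limit is taken in the product topology of R^d; the term of index j of
   the series is M^{-(j+1)} a_j, so that the exponents start at 1. *)
Definition attractor (R : realType) (d : nat) (M : 'M[int]_d)
    (D : set 'cV[int]_d) : set 'cV[R]_d :=
  [set x | exists2 a : nat -> 'cV[int]_d, (forall j, D (a j)) &
    series (fun j => invmx (map_mx intr M) ^+ j.+1 *m map_mx intr (a j))
      @ \oo --> x].
Arguments attractor R {d} M D.

Definition generates_2attractor (R : realType) (d : nat) (M : 'M[int]_d)
    (d0 d1 : 'cV[int]_d) : Prop :=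
  [/\ expanding R M,
      `|\det M| = 2
    & ~ exists z : 'cV[int]_d, d1 - d0 = M *m z].

Definition isotropic_2attractor (R : realType) (d : nat)
    (G : set 'cV[R]_d) : Prop :=
  exists M : 'M[int]_d, exists d0 d1 : 'cV[int]_d,
    [/\ generates_2attractor R M d0 d1,
        isotropic R M
      & G = attractor R M [set d0; d1]].

Definition affinely_similar (R : realType) (d : nat)
    (K L : set 'cV[R]_d) : Prop :=
  exists2 A : 'M[R]_d, A \in unitmx &
    exists b : 'cV[R]_d, L = [set A *m x + b | x in K].

Definition parallelepiped (R : realType) (d : nat) (K : set 'cV[R]_d) : Prop :=
  affinely_similar K [set x : 'cV[R]_d | forall i, 0 <= x i 0 <= 1].

Definition similar_to_2attractor_with (R : realType) (P : {poly int} -> Prop)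
    (K : set 'cV[R]_2) : Prop :=
  exists M : 'M[int]_2, exists d0 d1 : 'cV[int]_2,
    [/\ generates_2attractor R M d0 d1,
        P (char_poly M)
      & affinely_similar K (attractor R M [set d0; d1])].

Definition dragon (R : realType) (K : set 'cV[R]_2) : Prop :=
  similar_to_2attractor_with
    (fun p => p = 'X^2 - 2 *: 'X + 2%:P \/ p = 'X^2 + 2 *: 'X + 2%:P) K.

Definition bear (R : realType) (K : set 'cV[R]_2) : Prop :=
  similar_to_2attractor_with
    (fun p => p = 'X^2 - 'X + 2%:P \/ p = 'X^2 + 'X + 2%:P) K.

(* (R^2)^k is identified with R^(2k) by concatenation: mxvec_index i j has
   value 2 i + j. *)
Definition plane_block (R : realType) (k : nat) (x : 'cV[R]_(k * 2))
    (i : 'I_k) : 'cV[R]_2 :=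
  \col_(j < 2) x (mxvec_index i j) 0.

Definition direct_product (R : realType) (k : nat)
    (K : 'I_k -> set 'cV[R]_2) : set 'cV[R]_(k * 2) :=
  [set x | forall i, K i (plane_block x i)].

Definition product_of_dragons (R : realType) (k : nat)
    (S : set 'cV[R]_(k * 2)) : Prop :=
  exists2 K : 'I_k -> set 'cV[R]_2, (forall i, dragon (K i)) &
    S = direct_product K.

Definition product_of_bears (R : realType) (k : nat)
    (S : set 'cV[R]_(k * 2)) : Prop :=
  exists2 K : 'I_k -> set 'cV[R]_2, (forall i, bear (K i)) &
    S = direct_product K.

(* T is nonempty, its members lie in one affine similarity class, and that
   class contains an isotropic 2-attractor. *)
Definition is_isotropic_type (R : realType) (d : nat)
    (T : set 'cV[R]_d -> Prop) : Prop :=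
  [/\ exists K, T K,
      forall K L, T K -> T L -> affinely_similar K L
    & forall K, T K ->
        exists2 G, isotropic_2attractor G & affinely_similar G K].

Definition dissimilar_types (R : realType) (d : nat)
    (T U : set 'cV[R]_d -> Prop) : Prop :=
  forall K L, T K -> U L -> ~ affinely_similar K L.

(* Main.v *)
(** Write [v = d1 - d0]. Up to translation the attractor is the set of subset sums
    of the sequence [w_n = M^-(n+1) v]. By Cayley-Hamilton [w] satisfies the linear
    recurrence read off the characteristic polynomial, which is irreducible (its
    constant term is prime and its roots have modulus above 1), so [w] spans and the
    affine class of the attractor depends on that polynomial only.

    If all roots have the same modulus, with square [s], then [z |-> s / z] permutes
    them, so the polynomial is self-reciprocal with [s^k = 2]; comparing 2-adic
    valuations kills every coefficient except those of degree [0], [k], [2k]. This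
    leaves [X^2k + a X^k + b] with [b = -2, a = 0] or [b = 2, |a| <= 2]. The sequence
    [w] is then [k] interleaved copies of a planar sequence, hence the products, and
    changing signs in [w] only translates the set, hence the three classes.

    To separate the classes, call a functional tied when it has two maximisers on the
    set. For subset sums of [w] the tied functionals form the union of the hyperplanes
    [w_n^perp], and the number of distinct lines spanned by the [w_n] is [2k] for
    parallelepipeds, [4k] for dragons and at least [5k] for bears. *)

Require Import Defs.
From HB Require Import structures.
From mathcomp Require Import all_boot all_order all_algebra.
From mathcomp Require Import all_classical all_reals all_analysis.
From mathcomp Require Import complex separable ring lra zify.

Set Implicit Arguments.
Unset Strict Implicit.
Unset Printing Implicit Defensive.

Import Order.TTheory GRing.Theory Num.Theory.
Import numFieldNormedType.Exports.

Local Open Scope classical_set_scope.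
Local Open Scope ring_scope.

(** * Affine similarity and subset sums *)

Section AffineSimilarity.
Variables (R : realType) (d : nat).
Implicit Types (K L N : set 'cV[R]_d) (A : 'M[R]_d).

Lemma affinely_similar_sym K L : affinely_similar K L -> affinely_similar L K.
Proof.
move=> [A Au [b ->]]; exists (invmx A); first by rewrite unitmx_inv.
exists (- (invmx A *m b)); rewrite eqEsubset; split=> [x Kx|_ [_ [x Kx <-] <-]].
  by exists (A *m x + b); [exists x|rewrite mulmxDr mulKmx// addrK].
by rewrite mulmxDr mulKmx// addrK.
Qed.

Lemma affinely_similar_trans L K N :
  affinely_similar K L -> affinely_similar L N -> affinely_similar K N.
Proof.
move=> [A Au [b ->]] [B Bu [c ->]]; exists (B *m A).
  by rewrite unitmx_mul Au Bu.
exists (B *m b + c).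
rewrite eqEsubset; split=> [_ [_ [x Kx <-] <-]|_ [x Kx <-]].
  by exists x => //; rewrite mulmxDr mulmxA addrA.
by exists (A *m x + b); [exists x|rewrite mulmxDr mulmxA addrA].
Qed.

Lemma affinely_similar_translate K L b :
  (forall x, K x -> L (x + b)) -> (forall x, L x -> K (x - b)) ->
  affinely_similar K L.
Proof.
move=> KL LK; exists 1%:M; first exact: unitmx1.
exists b; rewrite eqEsubset; split=> [x Lx|_ [x Kx <-]].
  by exists (x - b); [exact: LK|rewrite mul1mx subrK].
by rewrite mul1mx; exact: KL.
Qed.

End AffineSimilarity.

Section ColumnConvergence.
Variables (R : realType) (d : nat).
Implicit Types (s : nat -> 'cV[R]_d) (x : 'cV[R]_d).

Lemma cvg_colP s x :
  s @ \oo --> x <-> forall i, (fun n => s n i 0) @ \oo --> x i 0.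
Proof.
split=> [sx i|sx].
  apply: (@continuous_cvg _ _ _ _ _ _ (fun M : 'cV[R]_d => M i 0)) => //.
  exact: coord_continuous.
apply/cvg_ballP => eps eps0.
have H i : \forall n \near \oo, ball (x i 0) eps (s n i 0).
  by move/cvg_ballP : (sx i); exact.
have := @filter_forall nat _ (fun i n => ball (x i 0) eps (s n i 0)) \oo _ H.
move=> H'; near=> n; split => // i j; rewrite ord1; move: i.
by near: n; exact: H'.
Unshelve. all: by end_near.
Qed.

Lemma cvg_mulmx (A : 'M[R]_d) s x :
  s @ \oo --> x -> (fun n => A *m s n) @ \oo --> A *m x.
Proof.
move=> /cvg_colP sx; apply/cvg_colP => i; rewrite mxE.
under eq_fun do rewrite mxE.
apply: (@cvg_big _ _ +%R) => //; first exact: add_continuous.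
by move=> j _; exact: cvgMr.
Qed.

Lemma cvg_mul_row (u : 'rV[R]_d) s x :
  s @ \oo --> x -> (fun n => (u *m s n) 0 0) @ \oo --> (u *m x) 0 0.
Proof.
move=> /cvg_colP sx; rewrite mxE.
under eq_fun do rewrite mxE.
apply: (@cvg_big _ _ +%R) => //; first exact: add_continuous.
by move=> j _; exact: cvgMr.
Qed.

End ColumnConvergence.

Section SubsetSums.
Variables (R : realType) (d : nat).
Implicit Types (w v : nat -> 'cV[R]_d) (e s : nat -> bool).

Definition subseries w e : nat -> 'cV[R]_d :=
  series (fun n => (e n)%:R *: w n).

Definition subsums w : set 'cV[R]_d :=
  [set x | exists e, subseries w e @ \oo --> x].

(** Convergence is asked of every selector at once: sign changes need it for the set of negated
    terms, ties for the set of terms on which a functional is positive. *)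
Definition subsummable w : Prop :=
  forall e, exists x : 'cV[R]_d, subseries w e @ \oo --> x.

Lemma subseries_mulmx (A : 'M[R]_d) w e n :
  subseries (fun m => A *m w m) e n = A *m subseries w e n.
Proof.
by rewrite /subseries !seriesEnat /= mulmx_sumr; apply: eq_bigr => i _; rewrite scalemxAr.
Qed.

Lemma subsums_mulmx (A : 'M[R]_d) w : A \in unitmx ->
  affinely_similar (subsums w) (subsums (fun n => A *m w n)).
Proof.
move=> Au; exists A => //; exists 0.
rewrite eqEsubset; split=> [x [e wx]|_ [x [e wx] <-]].
  exists (invmx A *m x); last by rewrite mulKVmx// addr0.
  exists e; move/(@cvg_mulmx _ _ (invmx A)): wx; apply: cvg_trans.
  apply: near_eq_cvg; apply: nearW => n.
  by rewrite subseries_mulmx mulKmx.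
exists e; rewrite addr0; have := @cvg_mulmx _ _ A _ _ wx; apply: cvg_trans.
by apply: near_eq_cvg; apply: nearW => n; rewrite subseries_mulmx.
Qed.

(* A term with negative sign ranges over [{0, - w_n} = {0, w_n} - w_n]. *)
Lemma subsums_sign w s : subsummable w ->
  affinely_similar (subsums w) (subsums (fun n => (-1) ^+ s n *: w n)).
Proof.
move=> /(_ s)[c wc]; apply: (@affinely_similar_translate _ _ _ _ (- c)).
  (* As numbers, [(-1)^s (e xor s) = e - s], so the new sum is the old one minus the sum [c] of the
     terms selected by [s]. *)
  move=> x [e wx]; exists (fun n => e n (+) s n).
  apply: cvg_trans (cvgB wx wc); apply: near_eq_cvg; apply: nearW => n.
  rewrite /subseries !seriesEnat /= !fctE /= -sumrB.
  apply: eq_bigr => i _; rewrite scalerA -scalerBl; congr (_ *: _).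
  by case: (e i); case: (s i); rewrite /= ?expr1 ?expr0; ring.
move=> x [e wx]; exists (fun n => e n (+) s n); rewrite opprK.
apply: cvg_trans (cvgD wx wc); apply: near_eq_cvg; apply: nearW => n.
rewrite /subseries !seriesEnat /= !fctE /= -big_split /=.
apply: eq_bigr => i _; rewrite scalerA -scalerDl; congr (_ *: _).
by case: (e i); case: (s i); rewrite /= ?expr1 ?expr0; ring.
Qed.

(** On [w] the shift [x] by [k] satisfies [x^2 = a x + b]: each residue class modulo [k] follows the
    same recurrence of order two. *)
Definition satrec (k : nat) (a b : R) w : Prop :=
  forall n, w (n + k + k)%N = a *: w (n + k)%N + b *: w n.

(** This is the remainder of [x^4] modulo [x^2 - a x - b], for [x] the shift by [k]. *)
Lemma satrec4 k a b w n : satrec k a b w ->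
  w (n + 4 * k)%N = (a ^+ 3 + 2 * a * b) *: w (n + k)%N
                    + (a ^+ 2 * b + b ^+ 2) *: w n.
Proof.
move=> H; have -> : (n + 4 * k = n + k + k + k + k)%N by lia.
rewrite !H; apply/colP => i; rewrite !mxE; ring.
Qed.

(* The coefficients are those of [satrec4]: the recurrence itself need not contract,
   its fourth iterate does, in all three classes. *)
Definition contractive (a b : R) : Prop :=
  `|a ^+ 3 + 2 * a * b| + `|a ^+ 2 * b + b ^+ 2| <= 2^-1.

End SubsetSums.

(** * Convergence of all subseries from a contracting recurrence *)

Section BoundedSums.
Variable R : realType.
Implicit Type x : nat -> R.

(** With [S] the partial sums, the recurrence bounds [S (n + m) - S m] by half of [S (n + m)];
    absorbing that half gives [S n <= S (n + m) <= 2 S m]. *)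
Lemma sum_recurrence_bounded (x : nat -> R) (m k : nat) (c e : R) :
  (forall n, 0 <= x n) -> (k <= m)%N -> 0 <= c -> 0 <= e -> c + e <= 2^-1 ->
  (forall n, x (n + m)%N <= c * x (n + k)%N + e * x n) ->
  forall n, \sum_(0 <= i < n) x i <= 2 * \sum_(0 <= i < m) x i.
Proof.
move=> x0 km c0 e0 ce H n.
set S := fun n => \sum_(0 <= i < n) x i.
have Smono p q : (p <= q)%N -> S p <= S q.
  move=> pq; rewrite /S [leRHS](big_cat_nat (n := p)) //= lerDl.
  by apply: sumr_ge0.
have Sshift p : \sum_(0 <= i < n) x (i + p)%N <= S (n + p)%N.
  rewrite /S [leRHS](big_cat_nat (n := p)) //=; last exact: leq_addl.
  rewrite -[p in leRHS]add0n big_addn addnK add0n lerDr.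
  by apply: sumr_ge0.
have SE : S (n + m)%N = S m + \sum_(0 <= i < n) x (i + m)%N.
  rewrite /S [LHS](big_cat_nat (n := m)) //=; last exact: leq_addl.
  by congr (_ + _); rewrite -{1}[m]add0n big_addn addnK.
have le1 : \sum_(0 <= i < n) x (i + m)%N <= 2^-1 * S (n + m)%N.
  apply: (@le_trans _ _ ((c + e) * S (n + m)%N)); last first.
    by apply: ler_wpM2r => //; apply: sumr_ge0.
  apply: (@le_trans _ _ (\sum_(0 <= i < n) (c * x (i + k)%N + e * x i))).
    by apply: ler_sum => i _; exact: H.
  rewrite big_split /= -!mulr_sumr mulrDl; apply: lerD; apply: ler_wpM2l => //.
    by apply: le_trans (Sshift k) _; apply: Smono; rewrite leq_add2l.
  by apply: Smono; exact: leq_addr.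
have : S n <= S (n + m)%N by apply: Smono; exact: leq_addr.
rewrite -/(S m) -/(S n); lra.
Qed.

Lemma cvg_abs_bounded (x : nat -> R) (C : R) :
  (forall n, \sum_(0 <= i < n) `|x i| <= C) ->
  forall e : nat -> bool, cvgn (series (fun n => (e n)%:R * x n)).
Proof.
move=> xC e; apply: normed_cvg; set y := fun n => _ * x n.
rewrite (_ : [normed series y] = fun n => \sum_(0 <= i < n) `|y i|) //.
apply: nondecreasing_is_cvgn.
  apply/nondecreasing_seqP => n.
  by rewrite big_nat_recr //= lerDl.
exists C => _ [n _ <-]; apply: le_trans (xC n); apply: ler_sum => i _.
by rewrite /y normrM ler_piMl //; case: (e i); rewrite ?normr1 ?normr0.
Qed.

Lemma contractive_subsummable d k a b (w : nat -> 'cV[R]_d) :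
  contractive a b -> satrec k a b w -> subsummable w.
Proof.
move=> ab wab e.
have H i : cvgn (series (fun n => (e n)%:R * w n i 0)).
  apply: (@cvg_abs_bounded _ (2 * \sum_(0 <= j < (4 * k)%N) `|w j i 0|)).
  apply: (@sum_recurrence_bounded (fun n => `|w n i 0|) _ k) ab _ => //.
    by lia.
  move=> n; rewrite (satrec4 _ wab) !mxE.
  by apply: le_trans (ler_normD _ _) _; rewrite !normrM.
exists (\col_i limn (series (fun n => (e n)%:R * w n i 0))).
apply/cvg_colP => i; rewrite mxE; move: (H i); apply: cvg_trans.
apply: near_eq_cvg; apply: nearW => n.
by rewrite /subseries !seriesEnat /= summxE; apply: eq_bigr => j _; rewrite mxE.
Qed.

End BoundedSums.

Section TotalSequences.
Variables (R : realType) (d : nat).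
Implicit Types (w v : nat -> 'cV[R]_d).

(** Only the first [d] terms are tested, so that they form a basis; a recurrence of order [d]
    determines the others. *)
Definition total_seq w : Prop :=
  forall u : 'rV[R]_d, (forall n, (n < d)%N -> u *m w n = 0) -> u = 0.

Definition seqmx w : 'M[R]_d := \matrix_(i, j) w j i 0.

Lemma col_seqmx w (j : 'I_d) : col j (seqmx w) = w j.
Proof. by apply/colP => i; rewrite !mxE. Qed.

Lemma col_mulmx m (A : 'M[R]_(m, d)) (B : 'M[R]_d) (j : 'I_d) :
  col j (A *m B) = A *m col j B.
Proof. by apply/colP => i; rewrite !mxE; apply: eq_bigr => l _; rewrite mxE. Qed.

Lemma total_seqmx_unit w : total_seq w -> seqmx w \in unitmx.
Proof.
move=> wt; rewrite -row_free_unit -kermx_eq0; apply/rowV0P => u /sub_kermxP uw.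
by apply: wt => n nd; rewrite -(col_seqmx w (Ordinal nd)) -col_mulmx uw col0.
Qed.

(** The linear map carrying the first [d] terms of [w] to those of [v] is invertible and respects
    the recurrence, so it carries all of [w] to [v]. *)
Lemma satrec_similar k a b w v : d = (k * 2)%N -> (0 < k)%N ->
  satrec k a b w -> satrec k a b v -> total_seq w -> total_seq v ->
  affinely_similar (subsums w) (subsums v).
Proof.
move=> dk k0 wab vab /total_seqmx_unit wu /total_seqmx_unit vu.
pose A := seqmx v *m invmx (seqmx w).
have Au : A \in unitmx by rewrite unitmx_mul vu unitmx_inv.
suff -> : v = (fun n => A *m w n) by exact: subsums_mulmx.
apply/funext; elim/ltn_ind => n IH; have [nd|dn] := ltnP n d.
  rewrite -(col_seqmx v (Ordinal nd)) -(col_seqmx w (Ordinal nd)) -col_mulmx.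
  by rewrite /A mulmxKV.
have -> : n = (n - d + k + k)%N by lia.
rewrite wab vab !IH; [|lia..].
by rewrite mulmxDr !scalemxAr.
Qed.

Lemma total_seq_sign w (s : nat -> bool) :
  total_seq w -> total_seq (fun n => (-1) ^+ s n *: w n).
Proof.
move=> wt u uw; apply: wt => n /uw; rewrite -scalemxAr => /eqP.
by rewrite scaler_eq0 signr_eq0 => /eqP.
Qed.

(** The sign is constant on blocks of length [k]: a shift by [k] reverses it and a shift by [2k]
    restores it, which affects only [a]. *)
Lemma satrec_oppl k a b w : (0 < k)%N -> satrec k a b w ->
  satrec k (- a) b (fun n => (-1) ^+ odd (n %/ k) *: w n).
Proof.
move=> k0 wab n; rewrite wab !divnDr ?divnn ?k0 //= !addn1 /=.
by case: odd; rewrite /= ?expr0 ?expr1 !scalerDr !scalerA; congr (_ *: _ + _ *: _); ring.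
Qed.

(** With blocks of length [2k] the shift by [2k] reverses the sign; the shift by [k] has coefficient
    zero. *)
Lemma satrec_oppr k b w : (0 < k)%N -> satrec k 0 b w ->
  satrec k 0 (- b) (fun n => (-1) ^+ odd (n %/ (k * 2)) *: w n).
Proof.
move=> k0 wab n; rewrite wab !scale0r !add0r -addnA addnn -muln2.
rewrite !divnDr ?divnn ?dvdnn ?muln_gt0 ?k0 //= !addn1 /=.
by case: odd; rewrite /= ?expr0 ?expr1 !scalerA; congr (_ *: _); ring.
Qed.

End TotalSequences.

Section SparseSeries.
Variable R : realType.

(** The upper bound on the right counts the indices below [n] congruent to [i] modulo [k]; in the
    induction it grows exactly when [n] is such an index. *)
Lemma sparse_sum k i (f : nat -> R) : (i < k)%N ->
  (forall n, (n %% k)%N != i -> f n = 0) ->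
  forall n, \sum_(0 <= j < n) f j =
            \sum_(0 <= m < (n + (k - i.+1)) %/ k) f (m * k + i)%N.
Proof.
move=> ik f0; have k0 : (0 < k)%N by apply: leq_trans ik.
elim=> [|n IH].
  by rewrite divn_small ?big_geq//; lia.
rewrite big_nat_recr //= IH.
have [/eqP ni|ni] := eqVneq (n %% k)%N i.
  have nE : n = (n %/ k * k + i)%N by rewrite {1}(divn_eq n k) (eqP ni).
  have -> : ((n + (k - i.+1)) %/ k = n %/ k)%N.
    by rewrite {1}nE -addnA divnMDl // (@divn_small (i + _)) ?addn0 //; lia.
  have -> : ((n.+1 + (k - i.+1)) %/ k = (n %/ k).+1)%N.
    have -> : (n.+1 + (k - i.+1) = (n %/ k).+1 * k)%N by rewrite mulSn; lia.
    by rewrite mulnK.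
  by rewrite big_nat_recr //= -nE.
rewrite (f0 _ ni) addr0; congr (\sum_(0 <= m < _) _).
have nlt := ltn_pmod n k0.
have nE := divn_eq n k.
have [ni'|ni'] := ltnP (n %% k) i.
  transitivity (n %/ k)%N.
    by rewrite {1}nE -addnA divnMDl // (@divn_small (n %% k + _)) ?addn0 //; lia.
  have -> : (n.+1 + (k - i.+1) = n %/ k * k + (n %% k + (k - i)))%N.
    by rewrite {1}nE; lia.
  by rewrite divnMDl // (@divn_small (n %% k + _)) ?addn0 //; lia.
have ni2 : (i < n %% k)%N by rewrite ltn_neqAle eq_sym ni.
transitivity (n %/ k).+1.
  have -> : (n + (k - i.+1) = (n %/ k).+1 * k + (n %% k - i.+1))%N.
    by rewrite {1}nE mulSn; lia.
  by rewrite divnMDl // (@divn_small (n %% k - _)) ?addn0 ?addn1 //; lia.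
have -> : (n.+1 + (k - i.+1) = (n %/ k).+1 * k + (n %% k - i))%N.
  by rewrite {1}nE mulSn; lia.
by rewrite divnMDl // (@divn_small (n %% k - _)) ?addn0 ?addn1 //; lia.
Qed.

(** Each sequence of partial sums is the other one along an index map tending to infinity: [m * k]
    one way, the count of [sparse_sum] the other way. *)
Lemma sparse_cvg k i (f : nat -> R) (x : R) : (i < k)%N ->
  (forall n, (n %% k)%N != i -> f n = 0) ->
  series f @ \oo --> x <-> series (fun m => f (m * k + i)%N) @ \oo --> x.
Proof.
move=> ik f0; have k0 : (0 < k)%N by apply: leq_trans ik.
have E n : series f n = series (fun m => f (m * k + i)%N) ((n + (k - i.+1)) %/ k)%N.
  by rewrite !seriesEnat /=; exact: sparse_sum.
split=> fx.
  have E' m : series (fun m => f (m * k + i)%N) m = series f (m * k)%N.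
    by rewrite E divnMDl // divn_small ?addn0 //; lia.
  rewrite (_ : series _ = series f \o (fun m => (m * k)%N)); last exact/funext.
  apply: cvg_comp fx.
  apply/cvgnyPge => A; near=> n.
  have : (A <= n)%N by near: n; exact: nbhs_infty_ge.
  by move=> /leq_trans; apply; exact: leq_pmulr.
rewrite (_ : series f = series (fun m => f (m * k + i)%N) \o
    (fun n => ((n + (k - i.+1)) %/ k)%N)); last by apply/funext => n /=.
apply: cvg_comp fx.
apply/cvgnyPge => A; near=> n.
have : (A * k <= n)%N by near: n; exact: nbhs_infty_ge.
move=> An; rewrite leq_divRL //; lia.
Unshelve. all: by end_near.
Qed.

End SparseSeries.

Section BinaryExpansions.
Variable R : realType.
Implicit Types x : R.

(** Orbit of the doubling map, with digit 1 from [1/2] on. The endpoint 1 is then fixed and gets the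
    expansion with all digits 1, so the closed interval is covered. *)
Fixpoint doubling x n : R :=
  if n is n'.+1 then
    let y := doubling x n' in if 2^-1 <= y then 2 * y - 1 else 2 * y
  else x.

Lemma doubling_range x n : 0 <= x <= 1 -> 0 <= doubling x n <= 1.
Proof.
move=> x01; elim: n => [//|n] /=.
by case: (leP 2^-1 (doubling x n)) => h /andP[h0 h1]; apply/andP; split; lra.
Qed.

Lemma doubling_sum x n :
  x = \sum_(0 <= i < n) (2^-1 <= doubling x i)%R%:R * 2 ^- i.+1
      + doubling x n * 2 ^- n.
Proof.
elim: n => [|n IH]; first by rewrite big_geq // expr0 invr1 mulr1 add0r.
rewrite big_nat_recr //= {1}IH -addrA; congr (_ + _).
have : 2 ^- n = 2 * 2 ^- n.+1 :> R.
  by rewrite exprS invfM mulrA mulfV ?mul1r // pnatr_eq0.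
by move=> ->; case: ifP => _ /=; ring.
Qed.

(** Forwards, the remainder in [doubling_sum] is at most [2^-n]. Backwards, the partial sums stay
    between 0 and [1 - 2^-n]. *)
Lemma binary_expansionP x : 0 <= x <= 1 <->
  exists e : nat -> bool,
    series (fun n => (e n)%:R * 2 ^- n.+1) @ \oo --> x.
Proof.
have half0 : (fun n => 2 ^- n) @ \oo --> (0 : R).
  have := @cvg_expr R 2^-1; rewrite ger0_norm ?invr_ge0 // invf_lt1 // ltr1n.
  move=> /(_ isT); apply: cvg_trans; apply: near_eq_cvg; apply: nearW => n.
  by rewrite /= exprVn.
split=> [x01|[e ex]].
  exists (fun n => 2^-1 <= doubling x n); apply/cvgrPdist_le => eps eps0.
  have /cvgrPdist_le /(_ _ eps0) := half0; apply: filterS => n.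
  rewrite sub0r normrN ger0_norm ?invr_ge0 ?exprn_ge0 // => h.
  rewrite [X in X - _](doubling_sum x n) seriesEnat /= addrC addKr.
  have /andP[h0 h1] := doubling_range n x01.
  have p0 : 0 <= 2 ^- n :> R by rewrite invr_ge0 exprn_ge0.
  rewrite ger0_norm ?mulr_ge0 //; apply: le_trans h.
  by rewrite ler_piMl.
have S0 n : 0 <= series (fun n => (e n)%:R * 2 ^- n.+1 : R) n.
  rewrite seriesEnat /=; apply: sumr_ge0 => i _.
  by rewrite mulr_ge0 // invr_ge0 exprn_ge0.
have S1 n : series (fun n => (e n)%:R * 2 ^- n.+1) n <= 1 - 2 ^- n :> R.
  elim: n => [|n IH]; first by rewrite seriesEnat /= big_geq // expr0 invr1 subrr.
  rewrite seriesSr; apply: le_trans (lerD IH (lexx _)) _.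
  have -> : 2 ^- n = 2 * 2 ^- n.+1 :> R.
    by rewrite exprS invfM mulrA mulfV ?mul1r // pnatr_eq0.
  have p0 : 0 <= 2 ^- n.+1 :> R by rewrite invr_ge0 exprn_ge0.
  by case: (e n) => /=; lra.
apply/andP; split.
  rewrite -(cvg_lim (@Rhausdorff R) ex); apply: limr_ge; first by apply/cvg_ex; exists x.
  exact: nearW.
rewrite -(cvg_lim (@Rhausdorff R) ex); apply: limr_le; first by apply/cvg_ex; exists x.
apply: nearW => n.
by apply: le_trans (S1 n) _; rewrite gerBl invr_ge0 exprn_ge0.
Qed.

End BinaryExpansions.

(** * Planar models and their products *)

Section Interleaving.
Variables (R : realType) (k : nat).
Hypothesis k0 : (0 < k)%N.
Implicit Types (w : nat -> 'cV[R]_2) (x : 'cV[R]_(k * 2)) (u : 'rV[R]_(k * 2)).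

(** Copies of a planar sequence run in turn through the [k] planes; [mxvec] makes the coordinates
    agree with those of [plane_block]. *)
Definition interleave w (n : nat) : 'cV[R]_(k * 2) :=
  (mxvec (\matrix_(i < k, j < 2)
     if i == (n %% k)%N :> nat then w (n %/ k)%N j 0 else 0))^T.

Definition row_block u (i : 'I_k) : 'rV[R]_2 := \row_j u 0 (mxvec_index i j).

Lemma plane_block_inj x y : plane_block x =1 plane_block y -> x = y.
Proof.
move=> xy; apply/colP => l; case/mxvec_indexP: l => i j.
by move/colP/(_ j): (xy i); rewrite !mxE.
Qed.

Lemma interleaveE w n i j : interleave w n (mxvec_index i j) 0 =
  if i == (n %% k)%N :> nat then w (n %/ k)%N j 0 else 0.
Proof. by rewrite mxE mxvecE mxE. Qed.

Lemma sum_blocks (F : 'I_(k * 2) -> R) :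
  \sum_l F l = \sum_i \sum_j F (mxvec_index i j).
Proof.
by rewrite (reindex _ (curry_mxvec_bij _ _)) /= pair_bigA; apply: eq_bigr => -[].
Qed.

Lemma mul_interleave u w n (i : 'I_k) : (n %% k)%N = i ->
  (u *m interleave w n) 0 0 = (row_block u i *m w (n %/ k)%N) 0 0.
Proof.
move=> ni; rewrite mxE sum_blocks (bigD1 i) //= [X in _ + X]big1 ?addr0; last first.
  move=> i' ii'; apply: big1 => j _.
  by rewrite interleaveE ni (_ : (_ == _) = false) ?mulr0 //; exact/negbTE.
by rewrite mxE; apply: eq_bigr => j _; rewrite interleaveE ni eqxx mxE.
Qed.

(** A shift by [k] stays in the same plane and advances the planar sequence by one. *)
Lemma satrec_interleave a b w : satrec 1 a b w -> satrec k a b (interleave w).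
Proof.
move=> wab n; apply/colP => l; case/mxvec_indexP: l => i j.
rewrite [RHS]mxE [X in _ = X + _]mxE [X in _ = _ + X]mxE !interleaveE.
rewrite !modnDr !divnDr ?dvdnn // divnn k0.
case: ifP => _; last by rewrite !mulr0 addr0.
by rewrite wab !mxE.
Qed.

Lemma total_seq_interleave w : total_seq w -> total_seq (interleave w).
Proof.
move=> wt u uw; apply/rowP => l; case/mxvec_indexP: l => i j.
have : row_block u i = 0.
  apply: wt => m m2; have ik := ltn_ord i.
  apply/rowP => c; rewrite ord1 [in RHS]mxE.
  have nd : (m * k + i < k * 2)%N by nia.
  have -> : m = ((m * k + i) %/ k)%N by rewrite divnMDl // divn_small ?addn0.
  by rewrite -mul_interleave ?uw ?mxE // modnMDl modn_small.
by move/rowP/(_ j); rewrite !mxE.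
Qed.

(** The selector at positions [m k + i] acts on plane [i] alone, so the selections in the [k] planes
    are independent. *)
Lemma subsums_interleave w :
  subsums (interleave w) = direct_product (fun _ : 'I_k => subsums w).
Proof.
have blockP (e : nat -> bool) x (i : 'I_k) :
    (forall j, (fun n => subseries (interleave w) e n (mxvec_index i j) 0)
       @ \oo --> x (mxvec_index i j) 0) <->
    subseries w (fun m => e (m * k + i)%N) @ \oo --> plane_block x i.
  rewrite cvg_colP.
  have E j : (fun n => subseries (interleave w) e n (mxvec_index i j) 0) @ \oo
        --> x (mxvec_index i j) 0 <->
      (fun n => subseries w (fun m => e (m * k + i)%N) n j 0) @ \oo
        --> plane_block x i j 0.
    rewrite [plane_block x i j 0]mxE.
    set f := fun n => (e n)%:R * interleave w n (mxvec_index i j) 0.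
    have -> : (fun n => subseries (interleave w) e n (mxvec_index i j) 0) = series f.
      apply/funext => n; rewrite /subseries !seriesEnat /= summxE.
      by apply: eq_bigr => m _; rewrite mxE.
    have -> : (fun n => subseries w (fun m => e (m * k + i)%N) n j 0)
        = series (fun m => f (m * k + i)%N).
      apply/funext => n; rewrite /subseries !seriesEnat /= summxE.
      apply: eq_bigr => m _; rewrite mxE /f interleaveE modnMDl modn_small //.
      by rewrite eqxx divnMDl // divn_small ?addn0.
    apply: sparse_cvg => // n ni; rewrite /f interleaveE eq_sym (negbTE ni).
    by rewrite mulr0.
  by split=> H j; apply/E.
rewrite eqEsubset; split=> [x [e /cvg_colP ex] i|x xw].
  by exists (fun m => e (m * k + i)%N); apply/blockP.
have [e ew] := choice xw.
(* The selectors of the planes are merged: position [n] reads digit [n %/ k] of plane [n %% k]. *)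
exists (fun n => e (Ordinal (ltn_pmod n k0)) (n %/ k)%N).
apply/cvg_colP => l; case/mxvec_indexP: l => i.
apply/blockP; move: (ew i); apply: cvg_trans; apply: near_eq_cvg.
apply: nearW => n; rewrite /subseries !seriesEnat /=.
apply: eq_bigr => m _; congr ((nat_of_bool _)%:R *: _).
rewrite divnMDl // divn_small ?addn0 //; congr (e _ _).
by apply: val_inj; rewrite /= modnMDl modn_small.
Qed.

(** The linear parts are assembled into a block-diagonal matrix [bd], inverted by the block-diagonal
    matrix of the inverses. *)
Lemma direct_product_similar (K L : 'I_k -> set 'cV[R]_2) :
  (forall i, affinely_similar (K i) (L i)) ->
  affinely_similar (direct_product K) (direct_product L).
Proof.
move=> KL.
have /choice[f Hf] i : exists p : 'M[R]_2 * 'cV[R]_2,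
    p.1 \in unitmx /\ L i = [set p.1 *m x + p.2 | x in K i].
  by have [A Au [b Lb]] := KL i; exists (A, b).
(* Recovers the plane and the coordinate within it, inverting [mxvec_index]. *)
pose blk (l : 'I_(k * 2)) : 'I_k * 'I_2 :=
  enum_val (cast_ord (esym (mxvec_cast k 2)) l).
have blkE i j : blk (mxvec_index i j) = (i, j).
  by rewrite /blk /mxvec_index cast_ordK enum_rankK.
pose bd (g : 'I_k -> 'M[R]_2) : 'M[R]_(k * 2) := \matrix_(p, q)
  if (blk p).1 == (blk q).1 then g (blk p).1 (blk p).2 (blk q).2 else 0.
have bdE g x i : plane_block (bd g *m x) i = g i *m plane_block x i.
  apply/colP => j; rewrite !mxE sum_blocks (bigD1 i) //= [X in _ + X]big1 ?addr0.
    by apply: eq_bigr => j' _; rewrite !mxE !blkE eqxx.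
  move=> i' ii'; apply: big1 => j' _.
  by rewrite mxE !blkE eq_sym (negbTE ii') mul0r.
have plane_blockD x y i : plane_block (x + y) i = plane_block x i + plane_block y i.
  by apply/colP => j; rewrite !mxE.
pose b : 'cV[R]_(k * 2) := (mxvec (\matrix_(i, j) (f i).2 j 0))^T.
have bE i : plane_block b i = (f i).2.
  by apply/colP => j; rewrite !mxE mxvecE mxE.
pose A := bd (fun i => (f i).1).
pose B := bd (fun i => invmx (f i).1).
have AB x : A *m (B *m x) = x.
  by apply: plane_block_inj => i; rewrite !bdE mulKVmx //; case: (Hf i).
exists A.
  have /mulmx1_unit[] // : A *m B = 1%:M.
  apply/matrixP => p q; have := AB (col q 1%:M).
  by rewrite mulmxA -col_mulmx mulmx1 => /colP/(_ p); rewrite [LHS]mxE [RHS]mxE.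
exists b; rewrite eqEsubset; split=> [y Ly|_ [x Kx <-] i].
  exists (B *m (y - b)); last by rewrite AB subrK.
  move=> i; have [fu Li] := Hf i.
  have : L i (plane_block y i) by exact: Ly.
  rewrite Li => -[z Kz zy]; rewrite bdE.
  suff -> : plane_block (y - b) i = (f i).1 *m z by rewrite mulKmx.
  by apply: (addIr (f i).2); rewrite zy -bE -plane_blockD subrK.
rewrite plane_blockD bdE bE; have [_ ->] := Hf i.
by exists (plane_block x i) => //; exact: Kx.
Qed.

End Interleaving.

Section CanonicalSequences.
Variables (R : realType).
Implicit Types (a b : R).

(** Two consecutive terms are carried along to make the recursion structural. *)
Fixpoint omega2 a b n : 'cV[R]_2 * 'cV[R]_2 :=
  if n is n'.+1 then
    let p := omega2 a b n' in (p.2, a *: p.2 + b *: p.1)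
  else (delta_mx 0 0, delta_mx 1 0).

(** The coordinates of [X^n] modulo [X^2 - a X - b] in the basis [1, X]. *)
Definition omega a b n : 'cV[R]_2 := (omega2 a b n).1.

Lemma satrec_omega a b : satrec 1 a b (omega a b).
Proof. by move=> n; rewrite !addn1. Qed.

Lemma total_seq_omega a b : total_seq (omega a b).
Proof.
move=> u uw; apply/rowP => j; rewrite mxE.
have colE (i : 'I_2) : (u *m (delta_mx i 0 : 'cV[R]_2)) 0 0 = u 0 i.
  by rewrite -colE mxE.
case: (fintype.unliftP 0 j) => [j'|] ->.
  have -> : lift 0 j' = 1 by apply: val_inj; rewrite /= ord1.
  by rewrite -colE (uw 1%N) // mxE.
by rewrite -colE (uw 0%N) // mxE.
Qed.

(** The parameters [(0, 1/2)], [(1, - 1/2)] and [(1/2, - 1/2)] give the representatives of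
    parallelepipeds, products of dragons and products of bears. *)
Definition canon k a b : set 'cV[R]_(k * 2) :=
  subsums (interleave k (omega a b)).

End CanonicalSequences.
Arguments canon {R} k a b.

(** * The unit cube as a set of subset sums *)

Section Cube.
Variables (R : realType) (d : nat).
Hypothesis d0 : (0 < d)%N.

(** The axes are visited in turn, each receiving the weights of a binary expansion. A full turn
    halves the terms, whence the recurrence with [a = 0] and [b = 1/2]. *)
Definition cube_seq n : 'cV[R]_d :=
  \col_(i < d) if (n %% d)%N == i then 2 ^- (n %/ d).+1 else 0.

Lemma total_seq_cube : total_seq cube_seq.
Proof.
move=> u uw; apply/rowP => j; rewrite mxE.
have /rowP/(_ 0) := uw j (ltn_ord j).
rewrite !mxE (bigD1 j) //= big1 ?addr0 => [|i ij]; last first.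
  rewrite mxE modn_small // (_ : (_ == _) = false) ?mulr0 //.
  by apply/negbTE; rewrite eq_sym.
rewrite mxE modn_small // eqxx => /eqP; rewrite mulf_eq0 => /orP[/eqP//|].
by rewrite invr_eq0 expf_eq0 /= pnatr_eq0.
Qed.

Lemma satrec_cube k : d = (k * 2)%N -> satrec k 0 2^-1 cube_seq.
Proof.
move=> dk n; rewrite scale0r add0r -addnA addnn -muln2 -dk.
apply/colP => i; rewrite !mxE modnDr; case: ifP => _; last by rewrite mulr0.
by rewrite divnDr ?dvdnn // divnn d0 addn1 [in LHS]exprS invfM.
Qed.

Lemma subsums_cube : subsums cube_seq = [set x : 'cV[R]_d | forall i, 0 <= x i 0 <= 1].
Proof.
have coordP (e : nat -> bool) (x : R) (i : 'I_d) :
    (fun n => subseries cube_seq e n i 0) @ \oo --> x <->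
    series (fun m => (e (m * d + i)%N)%:R * 2 ^- m.+1) @ \oo --> x.
  set f := fun n => (e n)%:R * cube_seq n i 0.
  have -> : (fun n => subseries cube_seq e n i 0) = series f.
    apply/funext => n; rewrite /subseries !seriesEnat /= summxE.
    by apply: eq_bigr => m _; rewrite mxE.
  have -> : (fun m => (e (m * d + i)%N)%:R * 2 ^- m.+1) = (fun m => f (m * d + i)%N).
    apply/funext => m; rewrite /f mxE modnMDl modn_small // eqxx.
    by rewrite divnMDl // divn_small ?addn0.
  by apply: sparse_cvg => // n ni; rewrite /f mxE (negbTE ni) mulr0.
rewrite eqEsubset; split=> [x [e /cvg_colP ex] i|x x01].
  by apply/binary_expansionP; exists (fun m => e (m * d + i)%N); apply/coordP.
have /choice[e ew] i : exists e : nat -> bool,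
    series (fun n => (e n)%:R * 2 ^- n.+1) @ \oo --> x i 0.
  exact/binary_expansionP.
exists (fun n => e (Ordinal (ltn_pmod n d0)) (n %/ d)%N).
apply/cvg_colP => i; apply/coordP; move: (ew i); apply: cvg_trans.
apply: near_eq_cvg; apply: nearW => n; rewrite !seriesEnat /=.
apply: eq_bigr => m _; congr ((nat_of_bool _)%:R * _).
rewrite divnMDl // divn_small ?addn0 //; congr (e _ _).
by apply: val_inj; rewrite /= modnMDl modn_small.
Qed.

End Cube.

(** * Tied functionals and the count of directions *)

Lemma nonroot (F : numDomainType) (p : {poly F}) : p != 0 -> exists t, p.[t] != 0.
Proof.
move=> p0; apply: contrapT => /forallNP H.
(* These are [size p] distinct points, one more than the number of roots [p] can have. *)
pose rs : seq F := [seq i%:R | i <- iota 0 (size p)].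
have : (size rs < size p)%N.
  apply: max_poly_roots => //.
    by apply/allP => t _; apply/eqP; have /negP := H t; rewrite negbK => /eqP.
  by rewrite map_inj_uniq ?iota_uniq //; exact: mulrIn.
by rewrite size_map size_iota ltnn.
Qed.

Section Ties.
Variables (R : realType) (d : nat).
Implicit Types (K L : set 'cV[R]_d) (u : 'rV[R]_d) (w v : nat -> 'cV[R]_d).

Definition dot u (x : 'cV[R]_d) : R := (u *m x) 0 0.

Lemma dotDr u x y : dot u (x + y) = dot u x + dot u y.
Proof. by rewrite /dot mulmxDr mxE. Qed.

Lemma dotZr u c x : dot u (c *: x) = c * dot u x.
Proof. by rewrite /dot -scalemxAr mxE. Qed.

Lemma dotBl u u' x : dot (u - u') x = dot u x - dot u' x.
Proof. by rewrite /dot mulmxBl [in LHS]mxE [X in _ + X]mxE. Qed.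

Lemma dotZl u c x : dot (c *: u) x = c * dot u x.
Proof. by rewrite /dot -scalemxAl mxE. Qed.

Lemma dot_suml (I : finType) (F : I -> 'rV[R]_d) x :
  dot (\sum_i F i) x = \sum_i dot (F i) x.
Proof. by rewrite /dot mulmx_suml summxE. Qed.

Lemma dot_sumr u (n : nat) (F : nat -> 'cV[R]_d) :
  dot u (\sum_(0 <= i < n) F i) = \sum_(0 <= i < n) dot u (F i).
Proof. by rewrite /dot mulmx_sumr summxE. Qed.

Lemma dot_delta i x : dot (delta_mx 0 i) x = x i 0.
Proof. by rewrite /dot -rowE mxE. Qed.

Lemma dot_mulmx u (A : 'M[R]_d) x : dot (u *m A) x = dot u (A *m x).
Proof. by rewrite /dot mulmxA. Qed.

(** Invariant under affine maps, hence fit for comparing sets; on subset sums it detects whether [u]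
    vanishes on some term. *)
Definition tie K u : Prop := exists x y,
  [/\ K x, K y, x <> y, forall z, K z -> dot u z <= dot u x & dot u x = dot u y].

Lemma tie_affine (A : 'M[R]_d) b K u : A \in unitmx -> tie K u ->
  tie [set A *m x + b | x in K] (u *m invmx A).
Proof.
move=> Au [x [y [Kx Ky xy xmax xeqy]]].
have E z : dot (u *m invmx A) (A *m z + b) = dot u z + dot (u *m invmx A) b.
  by rewrite dotDr dot_mulmx mulKmx.
exists (A *m x + b), (A *m y + b); split; [by exists x|by exists y| | |].
- by move=> /addIr H; apply: xy; rewrite -[x](mulKmx Au) H mulKmx.
- by move=> _ [z Kz <-]; rewrite !E lerD2r xmax.
- by rewrite !E xeqy.
Qed.

Lemma subseries_flip w (e : nat -> bool) (x : 'cV[R]_d) (n0 : nat) :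
  subseries w e @ \oo --> x ->
  subseries w (fun n => e n (+) (n == n0)) @ \oo --> x + (-1) ^+ e n0 *: w n0.
Proof.
move=> ex; have : (fun n => subseries w e n + (-1) ^+ e n0 *: w n0) @ \oo
    --> x + (-1) ^+ e n0 *: w n0.
  by apply: cvgD => //; exact: cvg_cst.
apply: cvg_trans; apply: near_eq_cvg; near=> n.
have nn0 : (n0 < n)%N by near: n; exact: nbhs_infty_gt.
rewrite /subseries !seriesEnat /= !big_mkord.
rewrite (bigD1 (Ordinal nn0)) //= [in RHS](bigD1 (Ordinal nn0)) //= eqxx.
rewrite addrAC; congr (_ + _).
- by rewrite -scalerDl; congr (_ *: _); case: (e n0); rewrite ?expr0 ?expr1 /=; ring.
- apply: eq_bigr => i ii0; congr ((nat_of_bool _)%:R *: _).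
  by rewrite (_ : (_ == _) = false) ?addbF //; exact/negbTE.
Unshelve. all: by end_near.
Qed.

(** Selecting the terms on which [u] is positive maximises [u]; toggling the term [n0], on which [u]
    vanishes, gives a second maximiser. *)
Lemma tie_subsums w u n0 : subsummable w -> w n0 <> 0 ->
  dot u (w n0) = 0 -> tie (subsums w) u.
Proof.
move=> ws w0 uw0; pose e n := 0 < dot u (w n); have [x ex] := ws e.
have := subseries_flip (n0 := n0) ex; set y := x + _ => ey.
exists x, y; split; [by exists e|by eexists; exact: ey| | |].
- rewrite /y => /(congr1 (fun z => z - x)); rewrite subrr [x + _]addrC addrK => /esym/eqP.
  by rewrite scaler_eq0 signr_eq0 => /eqP.
- move=> z [f fz].
  have fz' := (@cvg_mul_row _ _ u _ _ fz); have ex' := (@cvg_mul_row _ _ u _ _ ex).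
  rewrite /dot -(cvg_lim (@Rhausdorff R) fz') -(cvg_lim (@Rhausdorff R) ex').
  apply: ler_lim; [by apply/cvg_ex; eexists; exact: fz'|
    by apply/cvg_ex; eexists; exact: ex'|apply: nearW => n].
  rewrite -!/(dot _ _) /subseries !seriesEnat /= !dot_sumr; apply: ler_sum => i _.
  rewrite !dotZr /e.
  by case: ltP => h; case: (f i); rewrite /= ?mul1r ?mul0r // ltW.
- by rewrite /y dotDr dotZr uw0 mulr0 addr0.
Qed.

(** If [u] vanishes on no term, a maximiser must select exactly the terms where [u] is positive,
    since toggling any wrong digit would increase [u]. So the maximiser is unique. *)
Lemma tie_subsums_inv w u : tie (subsums w) u -> exists n, dot u (w n) = 0.
Proof.
move=> [x [y [xw yw xy xmax xeqy]]]; apply: contrapT => /forallNP uw.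
apply: xy.
have digit z : subsums w z -> dot u z = dot u x ->
    subseries w (fun n => 0 < dot u (w n)) @ \oo --> z.
  move=> [e ez] zx; suff -> : (fun n => 0 < dot u (w n)) = e by [].
  apply/funext => n; apply/eqP; apply: contrapT => /negP en.
  have /xmax : subsums w (z + (-1) ^+ e n *: w n).
    by eexists; exact: subseries_flip ez.
  rewrite dotDr dotZr zx gerDl; apply/negP.
  have /eqP un := uw n.
  by move: en; case: (e n); case: ltgtP un => //= h _ _; rewrite -ltNge ?expr1 ?expr0; lra.
have xs := digit _ xw erefl; have ys := digit _ yw (esym xeqy).
exact: (cvg_unique _ xs ys).
Qed.

(* Evaluating [sum_i t^i u_i] at a common nonroot [t] of finitely many nonzero
   polynomials escapes all the hyperplanes at once. *)
Lemma hyperplane_union m (v : 'I_m -> 'cV[R]_d) (w : 'cV[R]_d) :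
  (forall u, dot u w = 0 -> exists n, dot u (v n) = 0) ->
  exists n, forall u, dot u w = 0 -> dot u (v n) = 0.
Proof.
move=> H; apply: contrapT => /forallNP N.
have /choice[U HU] n : exists u, dot u w = 0 /\ dot u (v n) != 0.
  have /existsNP[u /not_implyP[uw uv]] := N n.
  by exists u; split => //; apply/eqP.
pose p n := \poly_(i < m) (if insub i is Some i' then dot (U i') (v n) else 0).
pose V t := \sum_(i < m) t ^+ i *: U i.
have pE n t : (p n).[t] = dot (V t) (v n).
  rewrite horner_poly dot_suml; apply: eq_bigr => i _.
  by rewrite valK dotZl mulrC.
have [t] : exists t, (\prod_n p n).[t] != 0.
  apply: nonroot; apply/prodf_neq0 => n _; apply/eqP => /polyP/(_ n).
  rewrite coef_poly ltn_ord valK coef0 => /eqP.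
  by apply/negP; case: (HU n).
rewrite horner_prod => /prodf_neq0 Ht.
have [|n] := H (V t).
  by rewrite dot_suml big1 // => i _; rewrite dotZl; case: (HU i) => -> _; rewrite mulr0.
by rewrite -pE => /eqP; apply/negP; exact: Ht.
Qed.

Lemma kernel_proportional (w v : 'cV[R]_d) :
  (forall u, dot u w = 0 -> dot u v = 0) -> exists c, v = c *: w.
Proof.
move=> H.
have [w0|/eqP w0] := pselect (w = 0).
  exists 0; rewrite scale0r; apply/colP => i; rewrite -dot_delta mxE; apply: H.
  by rewrite dot_delta w0 mxE.
have [i wi] : exists i, w i 0 != 0.
  apply: contrapT => /forallNP N; move/eqP: w0; apply; apply/colP => i; rewrite mxE.
  by have /negP := N i; rewrite negbK => /eqP.
exists (v i 0 / w i 0); apply/colP => l; rewrite mxE.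
(* This functional kills [w], and its vanishing on [v] expresses [v l 0] through [v i 0]. *)
have := H (delta_mx 0 l - (w l 0 / w i 0) *: delta_mx 0 i).
rewrite !dotBl !dotZl !dot_delta mulfVK // subrr => /(_ erefl) /eqP.
by rewrite subr_eq0 => /eqP ->; ring.
Qed.

(** Functionals killing [w j] are ties of the first set; transported by the affine map they are ties
    of the second, so each kills one of [v 0, ..., v (m - 1)]. By [hyperplane_union] a single [v n]
    serves them all, and its preimage under [A] is proportional to [w j]. Distinct lines therefore
    use distinct [n]. *)
Lemma direction_count w v m m' c : (0 < m)%N -> c != 0 ->
  subsummable w ->
  (forall j, (j < m')%N -> w j <> 0) ->
  (forall j j' r, (j < m')%N -> (j' < m')%N -> w j = r *: w j' -> j = j') ->
  (forall n, v n <> 0) -> (forall n, v (n + m)%N = c *: v n) ->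
  affinely_similar (subsums w) (subsums v) -> (m' <= m)%N.
Proof.
move=> m0 c0 ws w0 wdist v0 vper [A Au [b vE]].
have vfin u n : dot u (v n) = 0 -> exists n' : 'I_m, dot u (v n') = 0.
  elim/ltn_ind: n => n IH; have [nm uv|mn] := ltnP n m; first by exists (Ordinal nm).
  rewrite -(subnK mn) vper dotZr => /eqP; rewrite mulf_eq0 (negbTE c0) => /eqP.
  by apply: IH; lia.
pose v' (n : 'I_m) := invmx A *m v n.
have /choice[f fP] (j : 'I_m') : exists n : 'I_m, exists r, v' n = r *: w j.
  have [n Hn] : exists n : 'I_m, forall u, dot u (w j) = 0 -> dot u (v' n) = 0.
    apply: hyperplane_union => u uw.
    have := tie_subsums ws (w0 j (ltn_ord j)) uw.
    move=> /(tie_affine b Au); rewrite -vE => /tie_subsums_inv[n].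
    by move=> /vfin[n']; rewrite dot_mulmx; exists n'.
  by exists n; exact: kernel_proportional.
rewrite -(card_ord m') -(card_ord m); apply: (leq_card f) => j1 j2 f12.
apply: val_inj; have [r1 e1] := fP j1; have [r2 e2] := fP j2.
(* A zero factor would make a term of [v] vanish. *)
have r1n0 : r1 != 0.
  apply/eqP => r10; apply: (v0 (f j1)).
  by rewrite -[LHS](mulKVmx Au) -/(v' (f j1)) e1 r10 scale0r mulmx0.
apply: (wdist _ _ (r1^-1 * r2)); [exact: ltn_ord|exact: ltn_ord|].
rewrite -scalerA -e2 -f12 e1.
by rewrite scalerA mulVf // scale1r.
Qed.

Lemma periodic_neq0 w m c : (0 < m)%N -> c != 0 ->
  (forall n, w (n + m)%N = c *: w n) -> (forall n, (n < m)%N -> w n <> 0) ->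
  forall n, w n <> 0.
Proof.
move=> m0 c0 wper w0; elim/ltn_ind => n IH; have [/w0//|mn] := ltnP n m.
rewrite -(subnK mn) wper => /eqP; rewrite scaler_eq0 (negbTE c0) => /eqP.
by apply: IH; lia.
Qed.

End Ties.

Section CanonicalDissimilar.
Variables (R : realType) (k : nat).
Hypothesis k0 : (0 < k)%N.
Implicit Types a b : R.

Definition cross (x y : 'cV[R]_2) : R := x 0 0 * y 1 0 - x 1 0 * y 0 0.

Lemma plane_block_interleave (w : nat -> 'cV[R]_2) n (i : 'I_k) :
  plane_block (interleave k w n) i = if (n %% k)%N == i then w (n %/ k)%N else 0.
Proof.
apply/colP => j; rewrite mxE interleaveE eq_sym; case: ifP => // _.
by rewrite mxE.
Qed.

(** The first [q k] terms place [w 0, ..., w (q - 1)] in every plane. Within a plane the cross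
    products separate the lines; across planes the supports are disjoint. *)
Lemma interleave_independent (w : nat -> 'cV[R]_2) q : (1 < q)%N ->
  (forall m m', (m < m' < q)%N -> cross (w m) (w m') != 0) ->
  let W := interleave k w in
  (forall j, (j < q * k)%N -> W j <> 0) /\
  (forall j j' r, (j < q * k)%N -> (j' < q * k)%N -> W j = r *: W j' -> j = j').
Proof.
move=> q1 wc W.
have wc' m m' : (m < q)%N -> (m' < q)%N -> m != m' -> cross (w m) (w m') != 0.
  move=> mq m'q; rewrite neq_ltn => /orP[mm'|mm']; first by apply: wc; rewrite mm'.
  have -> : cross (w m) (w m') = - cross (w m') (w m) by rewrite /cross; ring.
  by rewrite oppr_eq0; apply: wc; rewrite mm'.
(* As [q > 1], some other index can be paired with [m], and a zero vector would make that cross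
   product vanish. *)
have w0 m : (m < q)%N -> w m <> 0.
  move=> mq wm0; have [m' /andP[m'q mm']] : exists m', (m' < q)%N && (m != m').
    by case: m mq {wm0} => [|m] mq; [exists 1%N|exists 0%N]; lia.
  by move: (wc' _ _ mq m'q mm'); rewrite wm0 /cross !mxE !mul0r subrr eqxx.
have blk j : plane_block (W j) (Ordinal (ltn_pmod j k0)) = w (j %/ k)%N.
  by rewrite plane_block_interleave eqxx.
have divq j : (j < q * k)%N -> (j %/ k < q)%N by rewrite ltn_divLR.
split=> [j jq Wj|j j' r jq j'q Wjj'].
  apply: (w0 _ (divq _ jq)); rewrite -blk Wj.
  by apply/colP => l; rewrite !mxE.
have := blk j; rewrite Wjj'; set i := Ordinal _.
have -> : plane_block (r *: W j') i = r *: plane_block (W j') i.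
  by apply/colP => l; rewrite !mxE.
rewrite plane_block_interleave /=; case: eqP => [jj'|_]; last first.
  by rewrite scaler0 => /esym /(w0 _ (divq _ jq)).
move=> wjj'; rewrite (divn_eq j k) (divn_eq j' k) jj'; congr (_ * _ + _)%N.
apply/eqP; apply: contrapT => /negP ne.
move: (wc' _ _ (divq _ jq) (divq _ j'q) ne); rewrite -wjj' /cross !mxE.
by move/eqP; apply; ring.
Qed.

End CanonicalDissimilar.

(** * Directions and contraction of the three planar sequences *)

Section OmegaCross.
Variable R : realType.
Implicit Types (a b x y : R).

Definition pt x y : 'cV[R]_2 := \col_(j < 2) if j == 0 then x else y.

Lemma cross_pt x y x' y' : cross (pt x y) (pt x' y') = x * y' - y * x'.
Proof. by rewrite /cross !mxE. Qed.

Lemma omega_pt a b :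
  [/\ omega a b 0 = pt 1 0, omega a b 1 = pt 0 1, omega a b 2 = pt b a,
      omega a b 3 = pt (a * b) (a ^+ 2 + b)
    & omega a b 4 = pt (a ^+ 2 * b + b ^+ 2) (a ^+ 3 + 2 * a * b)].
Proof.
have ptD u v x y x' y' : u *: pt x y + v *: pt x' y' = pt (u * x + v * x') (u * y + v * y').
  by apply/colP => j; rewrite !mxE; case: ifP.
have e0 : omega a b 0 = pt 1 0.
  by apply/colP => j; rewrite !mxE andbT; case: ifP.
have e1 : omega a b 1 = pt 0 1.
  by apply/colP => j; rewrite !mxE andbT; case: j => [[|[|]]].
have rec n : omega a b n.+2 = a *: omega a b n.+1 + b *: omega a b n by [].
have e2 : omega a b 2 = pt b a by rewrite rec e1 e0 ptD; congr (pt _ _); ring.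
have e3 : omega a b 3 = pt (a * b) (a ^+ 2 + b).
  by rewrite rec e2 e1 ptD; congr (pt _ _); ring.
split => //; rewrite rec e3 e2 ptD; congr (pt _ _); ring.
Qed.

Lemma omega_dragon_cross m m' : (m < m' < 4)%N ->
  cross (omega 1 (- 2^-1 : R) m) (omega 1 (- 2^-1) m') != 0.
Proof.
have [e0 e1 e2 e3 _] := omega_pt 1 (- 2^-1).
have {}e2 : omega 1 (- 2^-1) 2 = pt (- (1 / 2)) 1 by rewrite e2 div1r.
have {}e3 : omega 1 (- 2^-1) 3 = pt (- (1 / 2)) (1 / 2).
  by rewrite e3; congr (pt _ _); field.
move=> /andP[mm' m'4]; case: m' m'4 mm' => [|[|[|[|m']]]] // _;
  case: m => [|[|[|[|m]]]] // _; rewrite ?e0 ?e1 ?e2 ?e3 cross_pt;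
  apply/eqP => H; clear -H; lra.
Qed.

(** Five directions are enough: they exceed the four of the dragon. *)
Lemma omega_bear_cross m m' : (m < m' < 5)%N ->
  cross (omega 2^-1 (- 2^-1 : R) m) (omega 2^-1 (- 2^-1) m') != 0.
Proof.
have [e0 e1 e2 e3 e4] := omega_pt 2^-1 (- 2^-1).
have {}e2 : omega 2^-1 (- 2^-1) 2 = pt (- (1 / 2)) (1 / 2) by rewrite e2 div1r.
have {}e3 : omega 2^-1 (- 2^-1) 3 = pt (- (1 / 4)) (- (1 / 4)).
  by rewrite e3; congr (pt _ _); field.
have {}e4 : omega 2^-1 (- 2^-1) 4 = pt (1 / 8) (- (3 / 8)).
  by rewrite e4; congr (pt _ _); field.
move=> /andP[mm' m'4]; case: m' m'4 mm' => [|[|[|[|[|m']]]]] // _;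
  case: m => [|[|[|[|[|m]]]]] // _; rewrite ?e0 ?e1 ?e2 ?e3 ?e4 cross_pt;
  apply/eqP => H; clear -H; lra.
Qed.

Lemma contractive_parallelepiped : contractive (0 : R) 2^-1.
Proof.
rewrite /contractive -div1r.
have -> : 0 ^+ 3 + 2 * 0 * (1 / 2) = 0 :> R by field.
have -> : 0 ^+ 2 * (1 / 2) + (1 / 2) ^+ 2 = 1 / 4 :> R by field.
by rewrite normr0 ger0_norm; lra.
Qed.

Lemma contractive_dragon : contractive (1 : R) (- 2^-1).
Proof.
rewrite /contractive -div1r.
have -> : 1 ^+ 3 + 2 * 1 * - (1 / 2) = 0 :> R by field.
have -> : 1 ^+ 2 * - (1 / 2) + (- (1 / 2)) ^+ 2 = - (1 / 4) :> R by field.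
by rewrite normr0 normrN ger0_norm; lra.
Qed.

(** The two terms are [3/8] and [1/8], so the bound [1/2] is attained. *)
Lemma contractive_bear : contractive (2^-1 : R) (- 2^-1).
Proof.
rewrite /contractive -div1r.
have -> : (1 / 2) ^+ 3 + 2 * (1 / 2) * - (1 / 2) = - (3 / 8) :> R by field.
have -> : (1 / 2) ^+ 2 * - (1 / 2) + (- (1 / 2)) ^+ 2 = 1 / 8 :> R by field.
by rewrite normrN !ger0_norm; lra.
Qed.

End OmegaCross.

Section CanonDissimilar.
Variables (R : realType) (k : nat).
Hypothesis k0 : (0 < k)%N.

(** The primed set has at least [q' k] directions, while the other sequence repeats its directions
    after [q k] terms; [direction_count] forbids [q < q']. *)
Lemma canon_not_similar (a b a' b' c : R) q q' : (1 < q < q')%N -> c != 0 ->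
  contractive a' b' ->
  (forall m m', (m < m' < q')%N -> cross (omega a' b' m) (omega a' b' m') != 0) ->
  (forall m m', (m < m' < q)%N -> cross (omega a b m) (omega a b m') != 0) ->
  (forall n, interleave k (omega a b) (n + q * k)%N = c *: interleave k (omega a b) n) ->
  ~ affinely_similar (canon k a' b') (canon k a b).
Proof.
move=> /andP[q1 qq'] c0 ctr' cr' cr per sim.
have q'1 : (1 < q')%N by lia.
have qk0 : (0 < q * k)%N by rewrite muln_gt0 k0 andbT; lia.
have [w0 wd] := interleave_independent k0 q'1 cr'.
have [v0 _] := interleave_independent k0 q1 cr.
have ws : subsummable (interleave k (omega a' b')).
  by apply: contractive_subsummable ctr' _; apply: satrec_interleave (satrec_omega _ _).
have := direction_count qk0 c0 ws w0 wd (periodic_neq0 qk0 c0 per v0) per sim.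
by rewrite leq_pmul2r //; lia.
Qed.

(** Since [x^4 = - 1/4] modulo [x^2 - x + 1/2], the directions repeat after four rounds of the
    planes. *)
Lemma canon_dragon_period n : interleave k (omega 1 (- 2^-1 : R)) (n + 4 * k)%N =
  - (1 / 4) *: interleave k (omega 1 (- 2^-1)) n.
Proof.
rewrite (satrec4 _ (satrec_interleave k0 (satrec_omega _ _))) -div1r.
have -> : 1 ^+ 3 + 2 * 1 * - (1 / 2) = 0 :> R by field.
have -> : 1 ^+ 2 * - (1 / 2) + (- (1 / 2)) ^+ 2 = - (1 / 4) :> R by field.
by rewrite scale0r add0r.
Qed.

Lemma canon_parallelepiped_period n : interleave k (omega 0 (2^-1 : R)) (n + 2 * k)%N =
  2^-1 *: interleave k (omega 0 2^-1) n.
Proof.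
rewrite mul2n -addnn addnA (satrec_interleave k0 (satrec_omega _ _)).
by rewrite scale0r add0r.
Qed.

Lemma omega_parallelepiped_cross m m' : (m < m' < 2)%N ->
  cross (omega 0 (2^-1 : R) m) (omega 0 2^-1 m') != 0.
Proof.
have [e0 e1 _ _ _] := omega_pt (0 : R) 2^-1.
move=> /andP[mm' m'2]; case: m' m'2 mm' => [|[|m']] // _; case: m => [|m] // _.
by rewrite e0 e1 cross_pt mulr1 mulr0 subr0 oner_eq0.
Qed.

Lemma canon_dragon_not_parallelepiped :
  ~ affinely_similar (canon k 1 (- 2^-1)) (canon k 0 (2^-1 : R)).
Proof.
apply: (@canon_not_similar _ _ _ _ 2^-1 2 4) => //.
- exact: contractive_dragon.
- exact: omega_dragon_cross.
- exact: omega_parallelepiped_cross.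
- exact: canon_parallelepiped_period.
Qed.

Lemma canon_bear_not_parallelepiped :
  ~ affinely_similar (canon k 2^-1 (- 2^-1)) (canon k 0 (2^-1 : R)).
Proof.
apply: (@canon_not_similar _ _ _ _ 2^-1 2 5) => //.
- exact: contractive_bear.
- exact: omega_bear_cross.
- exact: omega_parallelepiped_cross.
- exact: canon_parallelepiped_period.
Qed.

Lemma canon_bear_not_dragon :
  ~ affinely_similar (canon k 2^-1 (- 2^-1)) (canon k 1 (- 2^-1 : R)).
Proof.
apply: (@canon_not_similar _ _ _ _ (- (1 / 4)) 4 5) => //.
- exact: contractive_bear.
- exact: omega_bear_cross.
- exact: omega_dragon_cross.
- exact: canon_dragon_period.
Qed.

End CanonDissimilar.

(** * Attractors as subset sums *)

Section Irreducibility.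
Variable R : realType.
Implicit Types f p q : {poly int}.

Definition roots_gt1 p : Prop :=
  forall z : R[i], root (map_poly intr p) z -> 1 < `|z|.

Lemma prod_norm_gt1 (rs : seq R[i]) : rs != [::] ->
  (forall z, z \in rs -> 1 < `|z|) -> 1 < \prod_(z <- rs) `|z|.
Proof.
elim: rs => [//|z [|z' rs] IH _ rs1]; rewrite big_cons.
  by rewrite big_nil mulr1 rs1 ?mem_head.
apply: (@lt_trans _ _ `|z|); first by rewrite rs1 ?mem_head.
rewrite -[ltLHS]mulr1 ltr_pM2l; last by rewrite (lt_trans ltr01) // rs1 ?mem_head.
by apply: IH => // x xrs; rewrite rs1 // inE xrs orbT.
Qed.

(** Up to sign the constant term is the leading coefficient, a nonzero integer, times the product of
    the roots. Monicity is not assumed, so this applies to factors. *)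
Lemma const_coef_gt1 f : (1 < size f)%N -> roots_gt1 f -> 1 < `|f`_0|.
Proof.
move=> f1 fr.
have inj : injective (intr : int -> R[i]) by exact: intr_inj.
have f0 : f != 0 by rewrite -size_poly_gt0; lia.
have [rs frs] := closed_field_poly_normal (map_poly intr f : {poly R[i]}).
have lc : lead_coef (map_poly intr f : {poly R[i]}) = (lead_coef f)%:~R.
  by rewrite lead_coef_map_inj.
have szf : size (map_poly intr f : {poly R[i]}) = size f.
  by rewrite size_map_inj_poly.
have lc0 : lead_coef f != 0 by rewrite lead_coef_eq0.
have lcC0 : (lead_coef f)%:~R != 0 :> R[i] by rewrite intr_eq0.
have rs0 : rs != [::].
  apply: contraTneq f1 => rs0; rewrite -szf frs rs0 big_nil lc alg_polyC size_polyC lcC0.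
  by [].
have rs1 z : z \in rs -> 1 < `|z|.
  by move=> zrs; apply: fr; rewrite frs lc rootZ // root_prod_XsubC.
have : (f`_0)%:~R = (lead_coef f)%:~R * \prod_(z <- rs) (- z) :> R[i].
  rewrite -lc -[LHS](coef_map (intr : {rmorphism int -> R[i]})) /= -horner_coef0 {1}frs.
  rewrite hornerZ horner_prod; congr (_ * _); apply: eq_bigr => z _.
  by rewrite hornerXsubC sub0r.
move=> /(congr1 Num.norm); rewrite normrM normr_prod.
under eq_bigr do rewrite normrN.
rewrite -!intr_norm => E; rewrite -(ltr_int R[i]) E.
apply: (@lt_le_trans _ _ (\prod_(z <- rs) `|z|)); first exact: prod_norm_gt1.
rewrite ler_peMl ?prodr_ge0 // ler1z.
by have := lc0; rewrite -normr_gt0; lia.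
Qed.

(** Two nonconstant integer factors would have constant terms of absolute value at least 2, and
    their product could not be 2. *)
Lemma roots_gt1_irreducible p : p \is monic -> (1 < size p)%N -> roots_gt1 p ->
  `|p`_0| = 2 -> irreducible_poly p.
Proof.
move=> pm p1 pr p2; split=> // q q1 qp.
have p0 := monic_neq0 pm.
have q0 : q != 0 by apply: contraTneq qp => ->; rewrite dvd0p.
(* Divisibility is up to scalars here; the primitive part of [q] divides [p] over the integers, with
   cofactor [r]. *)
have [r pE] := dvdpP_int qp.
have zq1 : (1 < size (zprimitive q))%N.
  by rewrite size_zprimitive ltn_neqAle eq_sym q1 size_poly_gt0.
have r0 : r != 0 by apply: contraNneq p0 => r0; rewrite pE r0 mulr0.
have [r1|r1] := leqP (size r) 1.
  rewrite (size1_polyC r1) in pE r0.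
  rewrite polyC_eq0 in r0.
  apply: (@eqp_trans _ (zprimitive q)).
    rewrite {1}(zpolyEprim q); apply: eqp_scale.
    by rewrite zcontents_eq0.
  by rewrite pE mulrC mul_polyC eqp_sym; apply: eqp_scale.
exfalso.
have rootsl : roots_gt1 (zprimitive q).
  by move=> z qz; apply: pr; rewrite pE rmorphM rootM qz.
have rootsr : roots_gt1 r.
  by move=> z qz; apply: pr; rewrite pE rmorphM rootM qz orbT.
have := const_coef_gt1 zq1 rootsl; have := const_coef_gt1 r1 rootsr.
move: p2; rewrite pE coef0M normrM; nia.
Qed.

End Irreducibility.

Section Cyclicity.
Variables (R : realType) (n' : nat).
Let d := n'.+1.
Variables (M : 'M[int]_d) (v : 'cV[int]_d).
Hypothesis irr : irreducible_poly (char_poly M).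
Hypothesis v0 : v != 0.

Definition krylov (T : pzRingType) (A : 'M[T]_d) (x : 'cV[T]_d) : 'M[T]_d :=
  \matrix_(i, j) (A ^+ i *m x) j 0.

Lemma krylov_map (T : pzRingType) (f : {rmorphism int -> T}) :
  map_mx f (krylov M v) = krylov (map_mx f M) (map_mx f v).
Proof.
apply/matrixP => i j; rewrite [LHS]mxE [X in f X]mxE [RHS]mxE.
by rewrite -rmorphXn -map_mxM [RHS]mxE.
Qed.

(** A rational dependence among the [M^i v] is a nonzero polynomial [f] of degree below [d] with
    [f(M) v = 0]. It is coprime to the irreducible characteristic polynomial, so Bezout and
    Cayley-Hamilton give [v = 0]. *)
Lemma krylov_det : \det (krylov M v) != 0.
Proof.
pose Mq : 'M[rat]_d := map_mx intr M; pose vq : 'cV[rat]_d := map_mx intr v.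
rewrite -(intr_eq0 rat) -det_map_mx krylov_map -/Mq -/vq -unitfE -unitmxE.
rewrite -row_free_unit -kermx_eq0; apply/rowV0P => c /sub_kermxP cK.
pose f := rVpoly c.
have fv : horner_mx Mq f *m vq = 0.
  have E j : (horner_mx Mq f *m vq) j 0 = (c *m krylov Mq vq) 0 j.
    rewrite /f /rVpoly poly_def raddf_sum /= mulmx_suml summxE [RHS]mxE.
    apply: eq_bigr => i _; rewrite valK linearZ /= rmorphXn /= horner_mx_X.
    by rewrite -scalemxAl mxE [krylov _ _ _ _]mxE.
  by apply/colP => j; rewrite E cK !mxE.
have vq0 : vq != 0.
  apply: contra v0 => /eqP vq0; apply/eqP/colP => i; move/colP/(_ i): vq0.
  by rewrite !mxE => /eqP; rewrite intr_eq0 => /eqP.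
apply/eqP; apply: contraT => c0.
have f0 : f != 0 by rewrite /f; apply: contra c0 => /eqP h; rewrite -[c]rVpolyK h linear0.
have irrq : irreducible_poly (char_poly Mq).
  by rewrite -map_char_poly; apply/irreducible_rat_int.
have /Bezout_eq1_coprimepP[[a b] /= ab] : coprimep (char_poly Mq) f.
  rewrite irreducible_poly_coprime //; apply/negP => /(dvdp_leq f0).
  by rewrite size_char_poly leqNgt ltnS size_poly.
case/negP: vq0; apply/eqP.
have : horner_mx Mq (a * char_poly Mq + b * f) *m vq = 0.
  by rewrite rmorphD !rmorphM /= Cayley_Hamilton mulr0 add0r -mulmxE -mulmxA fv mulmx0.
by rewrite ab rmorph1 mul1mx.
Qed.

Lemma krylov_unit : krylov (map_mx intr M : 'M[R]_d) (map_mx intr v) \in unitmx.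
Proof. by rewrite -krylov_map unitmxE det_map_mx unitfE intr_eq0 krylov_det. Qed.

End Cyclicity.

Lemma col_lin_solve (F : fieldType) d (x y z : 'cV[F]_d) (a b : F) : b != 0 ->
  x + a *: y + b *: z = 0 -> z = - (a / b) *: y + - b^-1 *: x.
Proof.
move=> b0 /colP H; apply/colP => i; move: (H i); rewrite !mxE => Hi.
have -> : x i 0 = - (a * y i 0 + b * z i 0).
  by apply/eqP; rewrite -addr_eq0 addrA Hi.
by field.
Qed.

Section AttractorSequence.
Variables (R : realType) (n' : nat).
Let d := n'.+1.
Variables (M : 'M[int]_d) (k : nat) (a b : int).
Hypothesis dk : d = (k * 2)%N.
Hypothesis pM : char_poly M = 'X^(k * 2) + a%:P * 'X^k + b%:P.
Hypothesis b0 : b != 0.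

Let Mr : 'M[R]_d := map_mx intr M.
Let N := invmx Mr.

Definition inverse_orbit (x : 'cV[R]_d) (n : nat) : 'cV[R]_d := N ^+ n.+1 *m x.

Let k0 : (0 < k)%N.
Proof. by move: dk; rewrite /d; case: (k). Qed.

Lemma det_neq0 : \det M != 0.
Proof.
have : (char_poly M)`_0 = b.
  rewrite pM !coefD coefXn coefCM coefXn coefC /=.
  by rewrite !(ltn_eqF (_ : 0 < _)%N) ?muln_gt0 ?k0 // mulr0 !add0r.
rewrite char_poly_det => E; apply: contraNneq b0 => M0.
by rewrite -E M0 mulr0.
Qed.

Let Mu : Mr \in unitmx.
Proof. by rewrite unitmxE det_map_mx unitfE intr_eq0 det_neq0. Qed.

Lemma inverse_cancel j m (x : 'cV[R]_d) : Mr ^+ j *m (N ^+ (m + j) *m x) = N ^+ m *m x.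
Proof.
elim: j => [|j IH] in m x *; first by rewrite addn0 expr0 mul1mx.
rewrite addnS exprSr exprS -mulmxA.
have -> : (N * N ^+ (m + j)) *m x = N *m (N ^+ (m + j) *m x) by rewrite mulmxA.
by rewrite mulKVmx.
Qed.

Lemma cancel_inverse j m (x : 'cV[R]_d) : N ^+ (m + j) *m (Mr ^+ j *m x) = N ^+ m *m x.
Proof.
elim: j => [|j IH] in m x *; first by rewrite addn0 expr0 mul1mx.
rewrite addnS exprSr exprS -mulmxA.
have -> : (Mr * Mr ^+ j) *m x = Mr *m (Mr ^+ j *m x) by rewrite mulmxA.
by rewrite mulKmx.
Qed.

Lemma recurrence_matrix : Mr ^+ (k * 2) + a%:~R *: Mr ^+ k + b%:~R *: 1%:M = 0.
Proof.
have := Cayley_Hamilton Mr.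
rewrite -map_char_poly pM !rmorphD !rmorphM /= !map_polyXn !map_polyC /=.
rewrite !rmorphXn /= !horner_mx_X !horner_mx_C => <-.
by rewrite -[b%:~R%:M]scalemx1 -mulmxE mul_scalar_mx.
Qed.

Lemma satrec_inverse_orbit x :
  satrec k (- (a%:~R / b%:~R)) (- b%:~R^-1) (inverse_orbit x).
Proof.
(* The matrix relation is applied to the latest term [y]: [M^k y] and [M^(2k) y] are the two earlier
   terms, and solving for [y] divides by [b]. *)
move=> n; set y := inverse_orbit x (n + k + k).
have bR : b%:~R != 0 :> R by rewrite intr_eq0.
have e1 : inverse_orbit x (n + k) = Mr ^+ k *m y.
  by rewrite /y /inverse_orbit -[(n + k + k).+1]addSn inverse_cancel.
have e2 : inverse_orbit x n = Mr ^+ (k * 2) *m y.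
  rewrite /y /inverse_orbit (_ : (n + k + k).+1 = (n.+1 + k * 2)%N) ?inverse_cancel //.
  by lia.
have : (Mr ^+ (k * 2) + a%:~R *: Mr ^+ k + b%:~R *: 1%:M) *m y = 0.
  by rewrite recurrence_matrix mul0mx.
rewrite !mulmxDl -!scalemxAl -e1 -e2 mul1mx => H.
exact: col_lin_solve.
Qed.

(** If [u] kills [N x, ..., N^d x], then [u N^d] kills [M^j x] for every [j < d], hence is zero by
    the Krylov determinant. *)
Lemma total_inverse_orbit (v : 'cV[int]_d) :
  irreducible_poly (char_poly M) -> v != 0 -> total_seq (inverse_orbit (map_mx intr v)).
Proof.
move=> irr v0 u uw; set x := map_mx intr v in uw.
have K := krylov_unit R irr v0.
have uK : u *m N ^+ d *m (krylov Mr x)^T = 0.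
  apply/rowP => j; rewrite [in RHS]mxE.
  have -> : (u *m N ^+ d *m (krylov Mr x)^T) 0 j = (u *m N ^+ d *m (Mr ^+ j *m x)) 0 0.
    by rewrite [LHS]mxE [RHS]mxE; apply: eq_bigr => l _; congr (_ * _);
    rewrite mxE [LHS]mxE.
  rewrite -mulmxA; have jd := ltn_ord j.
  have -> : N ^+ d = N ^+ (d - j + j) by rewrite subnK // ltnW.
  rewrite cancel_inverse.
  have := uw (d - j).-1; rewrite /inverse_orbit prednK ?subn_gt0 // => ->; last by lia.
  by rewrite mxE.
have u0 : u *m N ^+ d = 0.
  by rewrite -[LHS](mulmxK (_ : (krylov Mr x)^T \in unitmx)) ?uK ?mul0mx // unitmx_tr.
have NdU : N ^+ d \in unitmx.
  have -> : (N ^+ d \in unitmx) = (N ^+ d \is a GRing.unit) by [].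
  by rewrite unitrX // -[_ \is a GRing.unit]/(N \in unitmx) unitmx_inv.
by rewrite -[u](mulmxK NdU) u0 mul0mx.
Qed.

(** Writing a digit as [d0 + e (d1 - d0)] splits off the constant sum [c] of the series for [d0], so
    the two sets differ by a translation. *)
Lemma attractor_similar_orbit d0 d1 :
  contractive (- (a%:~R / b%:~R)) (- b%:~R^-1 : R) ->
  affinely_similar (attractor R M [set d0; d1])
    (subsums (inverse_orbit (map_mx intr (d1 - d0)))).
Proof.
move=> ctr.
have [c cP] : exists c : 'cV[R]_d, series (inverse_orbit (map_mx intr d0)) @ \oo --> c.
  (* Selecting every term gives convergence of the full series. *)
  have [c cP] := contractive_subsummable ctr (satrec_inverse_orbit (map_mx intr d0)) xpredT.
  exists c; move: cP; apply: cvg_trans; apply: near_eq_cvg; apply: nearW => n.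
  rewrite /subseries !seriesEnat /=.
  by apply: eq_bigr => i _; rewrite scale1r.
have E (e : nat -> bool) n :
    subseries (inverse_orbit (map_mx intr (d1 - d0))) e n
    + series (inverse_orbit (map_mx intr d0)) n =
    series (fun j => N ^+ j.+1 *m map_mx intr (if e j then d1 else d0)) n.
  rewrite /subseries !seriesEnat /= -big_split /=; apply: eq_bigr => i _.
  rewrite map_mxB /inverse_orbit mulmxBr; case: (e i) => /=.
    by rewrite scale1r subrK.
  by rewrite scale0r add0r.
apply: (@affinely_similar_translate _ _ _ _ (- c)).
  move=> x [g gD gx]; exists (fun j => g j == d1).
  apply: cvg_trans (cvgB gx cP); apply: near_eq_cvg; apply: nearW => n.
  rewrite !fctE /=; apply/eqP; rewrite subr_eq E; apply/eqP.
  rewrite !seriesEnat /=; apply: eq_bigr => i _; congr (_ *m map_mx _ _).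
  by case: eqP (gD i) => [->//|ne] [].
move=> x [e ex]; exists (fun j => if e j then d1 else d0).
  by move=> j; case: (e j); [right|left].
rewrite opprK; apply: cvg_trans (cvgD ex cP); apply: near_eq_cvg; apply: nearW => n.
by rewrite !fctE /= E.
Qed.

End AttractorSequence.

Lemma attractor_similar_subsums (R : realType) (d k : nat) (M : 'M[int]_d)
    (d0 d1 : 'cV[int]_d) (a b : int) :
  d = (k * 2)%N -> (0 < k)%N -> generates_2attractor R M d0 d1 ->
  char_poly M = 'X^(k * 2) + a%:P * 'X^k + b%:P -> `|b| = 2 ->
  let al := - (a%:~R / b%:~R) : R in let be := - b%:~R^-1 in
  contractive al be ->
  exists w, [/\ satrec k al be w, total_seq w
    & affinely_similar (attractor R M [set d0; d1]) (subsums w)].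
Proof.
case: d M d0 d1 => [|n'] M d0 d1 dk k0; first by move: k0; lia.
move=> [Mexp Mdet Mv] pM b2 al be ctr.
have b0 : b != 0 by apply: contra_eq_neq b2 => ->; rewrite normr0.
have p0 : `|(char_poly M)`_0| = 2 by rewrite char_poly_det normrM normrX normrN1 expr1n mul1r.
have irr : irreducible_poly (char_poly M).
  apply: (@roots_gt1_irreducible R) => //.
  - exact: char_poly_monic.
  - by rewrite size_char_poly.
  - by move=> z; rewrite map_char_poly => zr; apply: Mexp; rewrite eigenvalue_root_char.
(* The zero vector lies in the image of [M]. *)
have v0 : d1 - d0 != 0 by apply/eqP => v0; apply: Mv; exists 0; rewrite v0 mulmx0.
exists (@inverse_orbit R n' M (map_mx intr (d1 - d0))); split.
- exact: satrec_inverse_orbit.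
- exact: total_inverse_orbit dk pM b0 _ irr v0.
- exact: attractor_similar_orbit dk pM b0 _ _ ctr.
Qed.

(** * Characteristic polynomials with roots of equal modulus *)

Lemma prod_const_seq (T : pzRingType) (I : Type) (r : seq I) (c : T) :
  \prod_(i <- r) c = c ^+ size r.
Proof. by rewrite big_const_seq count_predT; exact: iter_mulr_1. Qed.

Section EqualModulus.
Variables (R : realType) (k : nat) (M : 'M[int]_(k * 2)).
Hypothesis k0 : (0 < k)%N.
Hypothesis Mdet : `|\det M| = 2.
Hypothesis Meq : forall z w : R[i], eigenvalue (map_mx intr M) z ->
  eigenvalue (map_mx intr M) w -> `|z| = `|w|.

Let d := (k * 2)%N.
Let p := char_poly M.
Let P : {poly R[i]} := map_poly intr p.

Let coefP i : P`_i = (p`_i)%:~R.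
Proof. exact: coef_map. Qed.

Let const_coef_char_poly : p`_0 = \det M.
Proof. by rewrite /p char_poly_det -signr_odd oddM andbF mul1r. Qed.

(* All roots lie on the circle [|z|^2 = s] with [s^k = 2], so [z |-> s / z]
   agrees with conjugation on the roots and permutes them. *)
Lemma char_poly_self_reciprocal : exists2 s : R[i], s ^+ k = 2 &
  (exists2 z : R[i], root P z & `|z| ^+ d = 2) /\
  forall i, (i <= d)%N -> (p`_0)%:~R * P`_i = P`_(d - i) * s ^+ (d - i).
Proof.
have [rs Prs] := closed_field_poly_normal P.
have Pm : P \is monic by rewrite monic_map // char_poly_monic.
rewrite (monicP Pm) scale1r in Prs.
have szP : size P = d.+1 by rewrite size_map_inj_poly ?size_char_poly //; exact: intr_inj.
have szrs : size rs = d by apply: succn_inj; rewrite -szP Prs size_prod_XsubC.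
have rsP z : (z \in rs) = root P z by rewrite Prs root_prod_XsubC.
have rsE z : z \in rs -> eigenvalue (map_mx intr M : 'M[R[i]]_(k * 2)) z.
  by rewrite rsP eigenvalue_root_char -map_char_poly.
have d0 : (0 < d)%N by rewrite muln_gt0 k0.
have [z0 z0rs] : exists z0, z0 \in rs.
  case: (rs) szrs => [szd|z0 rs' _]; first by move: d0; rewrite -szd.
  by exists z0; rewrite mem_head.
have sgnd : (-1) ^+ d = 1 :> R[i] by rewrite -signr_odd oddM andbF.
have prodE : \prod_(z <- rs) z = (p`_0)%:~R :> R[i].
  rewrite -coefP -horner_coef0 Prs horner_prod.
  under [RHS]eq_bigr do rewrite hornerXsubC sub0r -mulN1r.
  by rewrite big_split /= prod_const_seq szrs sgnd mul1r.
have modE : `|z0| ^+ d = 2.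
  have : `|(p`_0)%:~R : R[i]| = 2 by rewrite const_coef_char_poly -intr_norm Mdet.
  rewrite -prodE normr_prod (eq_big_seq (fun=> `|z0|)) ?prod_const_seq ?szrs //.
  by move=> z zrs; apply: Meq; exact: rsE.
pose s := `|z0| ^+ 2.
have sk : s ^+ k = 2 by rewrite /s -exprM mulnC.
have zconj z : z \in rs -> z * z^* = s.
  by move=> zrs; rewrite -normCK /s (Meq (rsE _ zrs) (rsE _ z0rs)).
exists s => //; split; first by exists z0; rewrite -?rsP.
(* [P] has integer coefficients, so conjugation fixes it. *)
have Pconj : P = \prod_(z <- rs) ('X - (z^*)%:P).
  have -> : P = map_poly Num.conj P.
    by apply/polyP => i; rewrite [RHS]coef_map /= coefP rmorph_int.
  rewrite Prs rmorph_prod; apply: eq_bigr => z _.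
  by rewrite /= map_polyXsubC.
(* [Q] is [X^d P(s / X)]. *)
pose Q := \poly_(i < d.+1) (P`_(d - i) * s ^+ (d - i)).
have QE x : x != 0 -> Q.[x] = x ^+ d * P.[s / x].
  move=> x0; rewrite horner_poly horner_coef szP mulr_sumr.
  rewrite (reindex_inj rev_ord_inj) /=; apply: eq_bigr => i _.
  have id := ltn_ord i; rewrite subSS subKn; last by lia.
  rewrite expr_div_n mulrCA -mulrA; congr (_ * _); rewrite mulrCA; congr (_ * _).
  by rewrite expfB_cond // (negbTE x0); lia.
(* Factor by factor, [z (x - conj z) = - x (s / x - z)] because [z conj z = s]; the signs cancel as
   [d] is even. *)
have PQ x : x != 0 -> (p`_0)%:~R * P.[x] = Q.[x].
  move=> x0; rewrite QE // -prodE [in LHS]Pconj [in RHS]Prs !horner_prod.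
  have -> : x ^+ d = (- x) ^+ d by rewrite exprNn sgnd mul1r.
  rewrite -szrs -prod_const_seq -!big_split /=.
  apply: eq_big_seq => z zrs; rewrite !hornerXsubC mulrBr (zconj _ zrs).
  by field.
have : (p`_0)%:~R *: P - Q = 0.
  apply/eqP; apply: contraT => D0.
  (* The factor [X] discards the point 0, which [PQ] does not cover. *)
  have : ((p`_0)%:~R *: P - Q) * 'X != 0 by rewrite mulf_neq0 // polyX_eq0.
  move=> /nonroot[x]; rewrite hornerMX hornerD hornerN hornerZ.
  have [->|x0] := eqVneq x 0; first by rewrite mulr0 eqxx.
  by rewrite PQ // subrr mul0r eqxx.
move=> /eqP; rewrite subr_eq0 => /eqP /polyP PQE i id.
by have := PQE i; rewrite coefZ [in RHS]coef_poly ltnS id.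
Qed.

Lemma isotropic_char_poly : exists a b : int,
  [/\ p = 'X^(k * 2) + a%:P * 'X^k + b%:P, `|b| = 2
    & (b = - 2 /\ a = 0) \/ (b = 2 /\ `|a| <= 2)].
Proof.
have [s sk [[z zP zd] recip]] := char_poly_self_reciprocal.
have b2 : `|p`_0| = 2 by rewrite const_coef_char_poly.
(* The [k]-th power of the reciprocity relation is an identity of integers,
   [p_0^k p_(d-j)^k = p_j^k 2^j]. If [p_j] is nonzero, 2-adic valuations give that [k] divides [j],
   and [0 < j < 2k] leaves only [j = k]. *)
have vanish j : (0 < j < d)%N -> j != k -> p`_j = 0.
  move=> /andP[j0 jd] jk; apply/eqP; apply: contraT => pj.
  have := recip (d - j)%N (leq_subr _ _); rewrite subKn ?(ltnW jd) // !coefP.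
  move=> /(congr1 (fun x => x ^+ k)); rewrite !exprMn -exprM mulnC exprM sk.
  rewrite -[2 ^+ _]/((2%:Z)%:~R ^+ _) -!rmorphXn -!rmorphM => /intr_inj.
  move=> /(congr1 absz); rewrite !abszM !abszX => E.
  have a2 : absz (p`_0)%R = 2%N by lia.
  rewrite a2 /= natrXE in E.
  have pj' : (0 < absz (p`_j)%R)%N by rewrite absz_gt0.
  have pi' : (0 < absz (p`_(d - j))%R)%N.
    rewrite lt0n; apply/eqP => h; move: E; rewrite h exp0n // muln0 => /esym/eqP.
    by rewrite muln_eq0 !expn_eq0 (gtn_eqF pj').
  move: E => /(congr1 (logn 2)); rewrite !lognM ?expn_gt0 ?pj' ?pi' // !lognX.
  rewrite logn_prime //= !muln1 => E.
  have : (k %| j)%N.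
    by rewrite -(dvdn_addr j (dvdn_mulr (logn 2 (absz (p`_j)%R)) (dvdnn k))) -E
      dvdn_addr ?dvdn_mulr.
  move=> /dvdnP[q jE]; move: jk jd j0; rewrite jE /d; case: q {jE} => [|[|q]]; nia.
have pE : p = 'X^(k * 2) + (p`_k)%:P * 'X^k + (p`_0)%:P.
  have kd : (k < d)%N by rewrite /d; lia.
  apply/polyP => i; rewrite !coefD coefXn coefCM coefXn coefC.
  have [->|i0] := eqVneq i 0%N.
    by rewrite !(ltn_eqF (_ : 0 < _)%N) ?muln_gt0 ?k0 // mulr0 !add0r.
  rewrite addr0; have [->|ik] := eqVneq i k.
    by rewrite -/d (ltn_eqF kd) add0r mulr1.
  rewrite mulr0 addr0; have [->|id] := eqVneq i (k * 2)%N.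
    by have /monicP := char_poly_monic M; rewrite lead_coefE size_char_poly.
  have [lid|gid] := ltnP i d; first by rewrite vanish //; lia.
  by rewrite nth_default // size_char_poly; lia.
exists (p`_k), (p`_0); split=> //.
(* In degree [k] the relation reads [p_0 p_k = 2 p_k], so [p_0 = - 2] forces [p_k = 0]. *)
have := recip k; rewrite (_ : d - k = k)%N; last by rewrite /d; lia.
have kd : (k <= d)%N by rewrite /d; lia.
rewrite sk coefP -[2]/((2%:Z)%:~R) -!rmorphM => /(_ kd)/intr_inj rk.
have [b2'|b2'] : p`_0 = 2 \/ p`_0 = - 2 by lia.
  right; split=> //.
  (* Replacing the constant term by [w conj w] lets [w^2 + c w + 2 = 0] be divided by [w], so
     [- c = w + conj w]. Then [|c|^2 <= 8], and the integer [p_k] has absolute value at most 2. *)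
  pose w := z ^+ k; pose c : R[i] := (p`_k)%:~R.
  have ww : w * w^* = 2 by rewrite -normCK normrX -exprM zd.
  have w0 : w != 0 by apply: contra_eq_neq ww => ->; rewrite mul0r eq_sym pnatr_eq0.
  have : w ^+ 2 + c * w + w * w^* = 0.
    have /eqP := zP; rewrite /P pE !rmorphD !rmorphM /= !map_polyXn !map_polyC /=.
    by rewrite !hornerE -/c exprM -/w b2' -[2%:~R]/2 -ww.
  move=> /eqP.
  rewrite expr2 -[c * w]mulrC -!mulrDr mulf_eq0 (negbTE w0) /= addrAC addr_eq0 => /eqP cE.
  have : `|c| <= `|w| + `|w|.
    by rewrite -[X in _ + X]norm_conjC -normrN -cE ler_normD.
  rewrite -mulr2n => cw.
  have : `|c| ^+ 2 <= 8.
    apply: le_trans (_ : (`|w| *+ 2) ^+ 2 <= _).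
      by rewrite lerXn2r // ?nnegrE ?normr_ge0 ?mulrn_wge0.
    by rewrite exprMn_n normCK ww -mulrnA.
  rewrite /c -intr_norm -rmorphXn -[8]/((8%:Z)%:~R) ler_int expr2.
  by move: `|p`_k| => x; nia.
by left; split=> //; move: rk; rewrite b2'; lia.
Qed.

End EqualModulus.

(** Otherwise the basis vectors have integer preimages, which form a right inverse of [M],
    impossible for determinant 2 up to sign. *)
Lemma exists_not_in_image (n : nat) (M : 'M[int]_n) : `|\det M| = 2 ->
  exists v : 'cV[int]_n, ~ exists z : 'cV[int]_n, v - 0 = M *m z.
Proof.
move=> M2; apply: contrapT => /forallNP H.
have /choice[f Hf] i : exists z : 'cV[int]_n, delta_mx i 0 - 0 = M *m z.
  exact: contrapT (H _).
pose X : 'M[int]_n := \matrix_(i, j) f j i 0.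
have /(congr1 determinant) : M *m X = 1%:M.
  apply/matrixP => i j; have /colP/(_ i) := Hf j; rewrite subr0 !mxE andbT => ->.
  by apply: eq_bigr => l _; rewrite mxE.
rewrite det_mulmx det1 => /(congr1 Num.norm); rewrite normrM M2 normr1; lia.
Qed.

(** * Existence of isotropic matrices for the admissible polynomials *)

Section AdmissiblePolynomials.
Variables (R : realType) (k : nat) (a b : int).
Hypothesis k0 : (0 < k)%N.
Hypothesis ab : (b = - 2 /\ a = 0) \/ (b = 2 /\ `|a| <= 2).

Definition admissible_poly : {poly int} := 'X^(k * 2) + a%:P * 'X^k + b%:P.

Let d := (k * 2)%N.
Let P : {poly R[i]} := map_poly intr admissible_poly.

Let PE z : P.[z] = (z ^+ k) ^+ 2 + a%:~R * z ^+ k + b%:~R.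
Proof.
by rewrite /P !rmorphD !rmorphM /= !map_polyXn !map_polyC /= !hornerE -exprM.
Qed.

Lemma size_admissible_poly : size admissible_poly = d.+1.
Proof.
rewrite /admissible_poly -addrA size_polyDl size_polyXn //.
apply: leq_ltn_trans (size_polyD _ _) _; rewrite gtn_max; apply/andP; split.
  rewrite mul_polyC; apply: leq_ltn_trans (size_scale_leq _ _) _.
  by rewrite size_polyXn; lia.
by apply: leq_ltn_trans (size_polyC_leq1 _) _; lia.
Qed.

Lemma admissible_poly_monic : admissible_poly \is monic.
Proof.
apply/monicP; rewrite lead_coefE size_admissible_poly /= /admissible_poly.
have kd : (k < d)%N by rewrite /d; lia.
have d0 : (0 < d)%N by lia.
by rewrite !coefD coefXn coefCM coefXn coefC -/d eqxx (gtn_eqF kd) (gtn_eqF d0) mulr0 !addr0.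
Qed.

Let a8 : a ^+ 2 < 8.
Proof. by case: ab => [[_ ->]//|[_ a2]]; rewrite expr2; nia. Qed.

(** The discriminant [a^2 - 8] is negative, so [w] is not real and [conj w] is the other root; the
    product of the roots is 2. *)
Lemma quadratic_root_norm (w : R[i]) :
  w ^+ 2 + a%:~R * w + 2 = 0 -> w * w^* = 2.
Proof.
move=> wP.
have wP' : w^* ^+ 2 + a%:~R * w^* + 2 = 0.
  by rewrite -[RHS](rmorph0 Num.conj) -wP rmorphD rmorphD rmorphXn
     rmorphM /= rmorph_int rmorph_nat.
(* The difference of the two equations factors. *)
have /eqP : (w - w^*) * (w + w^* + a%:~R) = 0.
  transitivity ((w ^+ 2 + a%:~R * w + 2) - (w^* ^+ 2 + a%:~R * w^* + 2)); first by ring.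
  by rewrite wP' [X in X - _]wP subrr.
rewrite mulf_eq0 => /orP[|].
  rewrite subr_eq0 eq_sym => /eqP/CrealP wr.
  have : 0 <= (2 * w + a%:~R) ^+ 2.
    by apply: real_exprn_even_ge0 => //; rewrite rpredD ?rpredM ?realz ?realn.
  have -> : (2 * w + a%:~R) ^+ 2 = 4 * (w ^+ 2 + a%:~R * w + 2) + (a%:~R ^+ 2 - 8) by ring.
  rewrite [X in 4 * X]wP mulr0 add0r -rmorphXn -[8]/((8%:Z)%:~R) -rmorphB ler0z.
  by move: a8; lia.
rewrite addrAC addr_eq0 => /eqP wE.
have -> : w^* = - (w + a%:~R) by rewrite wE opprK.
transitivity (2 - (w ^+ 2 + a%:~R * w + 2)); first by ring.
by rewrite [X in 2 - X]wP subr0.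
Qed.

Lemma root_power_norm z : root P z -> z ^+ k * (z ^+ k)^* = 2.
Proof.
move=> /rootP; rewrite PE; case: ab => [[-> ->]|[-> a2]].
  rewrite mul0r addr0 => /eqP; rewrite addr_eq0 -rmorphN opprK => /eqP w2.
  by rewrite -normCK -normrX w2 normr_nat.
exact: quadratic_root_norm.
Qed.

Lemma root_norm z : root P z -> `|z| ^+ d = 2.
Proof. by move=> /root_power_norm; rewrite -normCK normrX -exprM. Qed.

(** At a double root, with [w = z^k], the identity [z P'(z) = k w (2 w + a)] forces [2 w = - a].
    Then [w conj w = 2] gives [a^2 = 8], against [a^2 < 8]. *)
Lemma admissible_separable : coprimep P P^`().
Proof.
apply: Pdiv.ClosedField.root_coprimep => z zP; apply/negP => /eqP dz.
have zz := root_power_norm zP; set w := z ^+ k in zz.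
have w0 : w != 0 by apply: contra_eq_neq zz => ->; rewrite mul0r eq_sym pnatr_eq0.
have : k%:R * w * (2 * w + a%:~R) = z * (P^`()).[z].
  rewrite /P !rmorphD !rmorphM /= !map_polyXn !map_polyC /=.
  rewrite !derivD derivM !derivXn !derivC mul0r add0r addr0 !hornerE !hornerMn.
  rewrite !hornerXn -[k in RHS](prednK k0).
  rewrite (_ : (k.-1.+1 * 2).-1 = (k + k.-1)%N) ?prednK //; last by lia.
  rewrite -[(z ^+ (k + _)) *+ _]mulr_natr -[(z ^+ k.-1) *+ _]mulr_natr exprD natrM.
  have -> : w = z * z ^+ k.-1 by rewrite -exprS prednK.
  have -> : z ^+ k = z * z ^+ k.-1 by rewrite -exprS prednK.
  ring.
rewrite dz mulr0 => /eqP; rewrite !mulf_eq0 pnatr_eq0 (negbTE w0) orbF.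
rewrite (gtn_eqF k0) /= addr_eq0 => /eqP wa.
have : (8%:Z)%:~R = (a * a)%:~R :> R[i].
  transitivity (2 * w * (2 * w)^*).
    by rewrite rmorphM /= rmorph_nat mulrACA zz -!natrM.
  by rewrite wa rmorphN /= rmorph_int mulrNN -rmorphM.
move=> /intr_inj.
by have := a8; rewrite expr2; lia.
Qed.

Lemma exists_matrix_char_poly : exists M : 'M[int]_d, char_poly M = admissible_poly.
Proof.
have := companionmxK admissible_poly_monic; move: (companionmx _).
by rewrite size_admissible_poly => M; exists M.
Qed.

(** For a companion matrix, separability of the characteristic polynomial gives diagonalizability,
    and all roots have modulus [2^(1/d)] with [d = 2k]. *)
Lemma exists_isotropic_matrix : exists M : 'M[int]_(k * 2), exists d0 d1 : 'cV[int]_(k * 2),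
  [/\ generates_2attractor R M d0 d1, isotropic R M & char_poly M = admissible_poly].
Proof.
have [M pM] := exists_matrix_char_poly.
have M2 : `|\det M| = 2.
  have : `|(char_poly M)`_0| = 2.
    have d0 : (0 < d)%N by rewrite /d; lia.
    rewrite pM /admissible_poly !coefD coefXn coefCM coefXn coefC.
    rewrite -/d (ltn_eqF d0) (ltn_eqF k0) mulr0 !add0r.
    by case: ab => [[-> _]|[-> _]].
  by rewrite char_poly_det normrM normrX normrN1 expr1n mul1r.
have [v vP] := exists_not_in_image M2.
have evP z : eigenvalue (map_mx intr M : 'M[R[i]]_(k * 2)) z -> `|z| ^+ d = 2.
  by rewrite eigenvalue_root_char -map_char_poly pM; exact: root_norm.
have d0 : (0 < d)%N by rewrite /d; lia.
exists M, 0, v; split; [split; [|exact: M2|exact: vP]|split|exact: pM].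
- move=> z /evP zd; have := expr_gt1 d0 (normr_ge0 z); rewrite zd => <-.
  by rewrite ltr1n.
- have : char_poly (map_mx intr M : 'M[R[i]]_(k * 2)) = P by rewrite -map_char_poly pM.
  move: (map_mx intr M : 'M[R[i]]_(k * 2)) => A.
  move: d0; rewrite /d; case: (k * 2)%N A => [//|n] A _ AP.
  apply/diagonalizableP.
  have [rs rsP] := closed_field_poly_normal P.
  have /monicP lc : P \is monic by rewrite -AP char_poly_monic.
  rewrite lc scale1r in rsP; exists rs; last by rewrite -rsP -AP mxminpoly_dvd_char.
  by rewrite -separable_prod_XsubC -rsP unlock admissible_separable.
- move=> z w /evP zd /evP wd; apply: (pexpIrn d0); rewrite ?nnegrE ?normr_ge0 //.
  by rewrite /= zd.
Qed.

End AdmissiblePolynomials.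

(** * The three classes *)

Section NormalForm.
Variables (R : realType) (d k : nat).
Hypothesis dk : d = (k * 2)%N.
Hypothesis k0 : (0 < k)%N.

Lemma satrec_similar_oppl (a b : R) (w v : nat -> 'cV[R]_d) : contractive a b ->
  satrec k a b w -> satrec k (- a) b v -> total_seq w -> total_seq v ->
  affinely_similar (subsums w) (subsums v).
Proof.
move=> ab wab vab wt vt.
apply: affinely_similar_trans
  (subsums_sign (fun n => odd (n %/ k)) (contractive_subsummable ab wab)) _.
exact: satrec_similar dk k0 (satrec_oppl k0 wab) vab (total_seq_sign wt) vt.
Qed.

Lemma satrec_similar_oppr (b : R) (w v : nat -> 'cV[R]_d) : contractive 0 b ->
  satrec k 0 b w -> satrec k 0 (- b) v -> total_seq w -> total_seq v ->
  affinely_similar (subsums w) (subsums v).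
Proof.
move=> b0 wb vb wt vt.
apply: affinely_similar_trans
  (subsums_sign (fun n => odd (n %/ (k * 2))) (contractive_subsummable b0 wb)) _.
exact: satrec_similar dk k0 (satrec_oppr k0 wb) vb (total_seq_sign wt) vt.
Qed.

Lemma contractive_oppl (a b : R) : contractive a b -> contractive (- a) b.
Proof.
rewrite /contractive sqrrN.
have -> : (- a) ^+ 3 + 2 * - a * b = - (a ^+ 3 + 2 * a * b) by ring.
by rewrite normrN.
Qed.

Lemma contractive_oppr (b : R) : contractive 0 b -> contractive 0 (- b).
Proof.
by rewrite /contractive sqrrN !expr0n /= !mulr0 !mul0r.
Qed.

Variables (M : 'M[int]_d) (d0 d1 : 'cV[int]_d) (a b : int).
Hypothesis gM : generates_2attractor R M d0 d1.
Hypothesis pM : char_poly M = admissible_poly k a b.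
Variable w : nat -> 'cV[R]_d.
Hypothesis wt : total_seq w.

(** The orbit follows the recurrence with coefficient [- 1/b]: a sign change is needed for [b = 2],
    none for [b = - 2]. *)
Lemma attractor_parallelepiped : a = 0 -> `|b| = 2 -> satrec k 0 2^-1 w ->
  affinely_similar (attractor R M [set d0; d1]) (subsums w).
Proof.
move=> a0 b2 wr; have c := contractive_parallelepiped R.
have H := attractor_similar_subsums dk k0 gM pM b2; move: H; rewrite a0 mul0r oppr0 /=.
have [->|->] : b = 2 \/ b = - 2 by lia.
  move=> /(_ (contractive_oppr c)) [v [vr vt sim]].
  apply: affinely_similar_trans sim _; apply: affinely_similar_sym.
  exact: satrec_similar_oppr c wr vr wt vt.
rewrite rmorphN invrN opprK => /(_ c) [v [vr vt sim]].
apply: affinely_similar_trans sim _.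
exact: satrec_similar dk k0 vr wr vt wt.
Qed.

(** The middle coefficient of the orbit is [- a / 2]; when it equals [- al], a sign change corrects
    it. *)
Lemma attractor_quadratic (al : R) : b = 2 ->
  al = a%:~R / 2 \/ al = - (a%:~R / 2) -> contractive al (- 2^-1) ->
  satrec k al (- 2^-1) w ->
  affinely_similar (attractor R M [set d0; d1]) (subsums w).
Proof.
move=> b2 ala c wr.
have bn : `|b| = 2 by rewrite b2.
have := attractor_similar_subsums dk k0 gM pM bn; rewrite b2 /= -[2%:~R]/(2%:R).
case: ala => alE.
  rewrite -alE => /(_ (contractive_oppl c)) [v [vr vt sim]].
  apply: affinely_similar_trans sim _; apply: affinely_similar_sym.
  exact: satrec_similar_oppl c wr vr wt vt.
rewrite -alE => /(_ c) [v [vr vt sim]].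
apply: affinely_similar_trans sim _.
exact: satrec_similar dk k0 vr wr vt wt.
Qed.

End NormalForm.

Section PlaneTypes.
Variable R : realType.

Lemma dragon_poly : 'X^2 - 2 *: 'X + 2%:P = admissible_poly 1 (- 2) 2 /\
  'X^2 + 2 *: 'X + 2%:P = admissible_poly 1 2 2.
Proof. by rewrite /admissible_poly mul1n expr1 !mul_polyC scaleNr. Qed.

Lemma bear_poly : 'X^2 - 'X + 2%:P = admissible_poly 1 (- 1) 2 /\
  'X^2 + 'X + 2%:P = admissible_poly 1 1 2.
Proof. by rewrite /admissible_poly mul1n expr1 !mul_polyC scaleNr scale1r. Qed.

Lemma dragon_similar (K : set 'cV[R]_2) : dragon K ->
  affinely_similar K (subsums (omega 1 (- 2^-1))).
Proof.
move=> [M [d0 [d1 [gM pM sim]]]]; apply: affinely_similar_trans sim _.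
have c := contractive_dragon R; have [e1 e2] := dragon_poly.
have t : total_seq (omega 1 (- 2^-1 : R)) by exact: total_seq_omega.
have r := satrec_omega 1 (- 2^-1 : R).
by case: pM => pM; [rewrite e1 in pM|rewrite e2 in pM];
  apply: (attractor_quadratic (k := 1) _ _ gM pM t) c r => //;
  [right; rewrite rmorphN mulNr opprK mulfV ?intr_eq0|left; rewrite mulfV ?pnatr_eq0].
Qed.

Lemma bear_similar (K : set 'cV[R]_2) : bear K ->
  affinely_similar K (subsums (omega 2^-1 (- 2^-1))).
Proof.
move=> [M [d0 [d1 [gM pM sim]]]]; apply: affinely_similar_trans sim _.
have c := contractive_bear R; have [e1 e2] := bear_poly.
have t : total_seq (omega 2^-1 (- 2^-1 : R)) by exact: total_seq_omega.
have r := satrec_omega 2^-1 (- 2^-1 : R).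
by case: pM => pM; [rewrite e1 in pM|rewrite e2 in pM];
  apply: (attractor_quadratic (k := 1) _ _ gM pM t) c r => //;
  [right; rewrite rmorphN mulNr opprK mul1r|left; rewrite mul1r].
Qed.

Lemma dragon_omega : dragon (subsums (omega 1 (- 2^-1 : R))).
Proof.
have ab : (2 = - 2 :> int /\ 2 = 0 :> int) \/ (2 = 2 :> int /\ `|2 : int| <= 2) by right.
have [M [d0 [d1 [gM _ pM]]]] := @exists_isotropic_matrix R 1 2 2 isT ab.
exists M, d0, d1; split => //; first by right; rewrite pM; case: dragon_poly.
apply: affinely_similar_sym.
apply: (@attractor_quadratic R 2 1 _ _ M d0 d1 2 2 gM pM) => //.
- exact: total_seq_omega.
- by left; rewrite mulfV ?pnatr_eq0.
- exact: contractive_dragon.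
- exact: satrec_omega.
Qed.

Lemma bear_omega : bear (subsums (omega 2^-1 (- 2^-1 : R))).
Proof.
have ab : (2 = - 2 :> int /\ 1 = 0 :> int) \/ (2 = 2 :> int /\ `|1 : int| <= 2) by right.
have [M [d0 [d1 [gM _ pM]]]] := @exists_isotropic_matrix R 1 1 2 isT ab.
exists M, d0, d1; split => //; first by right; rewrite pM; case: bear_poly.
apply: affinely_similar_sym.
apply: (@attractor_quadratic R 2 1 _ _ M d0 d1 1 2 gM pM) => //.
- exact: total_seq_omega.
- by left; rewrite mul1r.
- exact: contractive_bear.
- exact: satrec_omega.
Qed.

End PlaneTypes.

Section CanonicalTypes.
Variables (R : realType) (k : nat).
Hypothesis k0 : (0 < k)%N.

Lemma canon_total a b : total_seq (interleave k (omega a b : nat -> 'cV[R]_2)).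
Proof. exact/total_seq_interleave/total_seq_omega. Qed.

Lemma canon_satrec (a b : R) : satrec k a b (interleave k (omega a b)).
Proof. exact/satrec_interleave/satrec_omega. Qed.

Lemma cube_canon :
  affinely_similar [set x : 'cV[R]_(k * 2) | forall i, 0 <= x i 0 <= 1] (canon k 0 2^-1).
Proof.
have d0 : (0 < k * 2)%N by lia.
rewrite -subsums_cube //.
apply: satrec_similar erefl k0 _ (@canon_satrec _ _) _ (@canon_total _ _).
- exact: satrec_cube.
- exact: total_seq_cube.
Qed.

Lemma parallelepiped_canon (K : set 'cV[R]_(k * 2)) : parallelepiped K ->
  affinely_similar K (canon k 0 2^-1).
Proof. by move=> KC; apply: affinely_similar_trans KC cube_canon. Qed.

Lemma product_of_dragons_canon (S : set 'cV[R]_(k * 2)) : product_of_dragons S ->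
  affinely_similar S (canon k 1 (- 2^-1)).
Proof.
move=> [K KD ->]; rewrite /canon subsums_interleave //.
by apply: direct_product_similar => i; exact: dragon_similar.
Qed.

Lemma product_of_bears_canon (S : set 'cV[R]_(k * 2)) : product_of_bears S ->
  affinely_similar S (canon k 2^-1 (- 2^-1)).
Proof.
move=> [K KD ->]; rewrite /canon subsums_interleave //.
by apply: direct_product_similar => i; exact: bear_similar.
Qed.

Lemma canon_product_of_dragons : product_of_dragons (canon k 1 (- 2^-1 : R)).
Proof.
exists (fun=> subsums (omega 1 (- 2^-1))); first by move=> _; exact: dragon_omega.
exact: subsums_interleave.
Qed.

Lemma canon_product_of_bears : product_of_bears (canon k 2^-1 (- 2^-1 : R)).
Proof.
exists (fun=> subsums (omega 2^-1 (- 2^-1))); first by move=> _; exact: bear_omega.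
exact: subsums_interleave.
Qed.

Lemma canon_parallelepiped : parallelepiped (canon k 0 (2^-1 : R)).
Proof. exact/affinely_similar_sym/cube_canon. Qed.

Lemma isotropic_type_of_canon (T : set 'cV[R]_(k * 2) -> Prop) (C : set 'cV[R]_(k * 2)) :
  T C -> (forall K, T K -> affinely_similar K C) ->
  (exists2 G, isotropic_2attractor G & affinely_similar G C) -> is_isotropic_type T.
Proof.
move=> TC TK [G iG GC]; split; first by exists C.
- move=> K L /TK KC /TK LC.
  exact: affinely_similar_trans KC (affinely_similar_sym LC).
- move=> K /TK KC; exists G => //.
  exact: affinely_similar_trans GC (affinely_similar_sym KC).
Qed.

Lemma dissimilar_of_canon (T U : set 'cV[R]_(k * 2) -> Prop) (C D : set 'cV[R]_(k * 2)) :
  (forall K, T K -> affinely_similar K C) -> (forall K, U K -> affinely_similar K D) ->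
  ~ affinely_similar D C -> dissimilar_types T U.
Proof.
move=> TC UD CD K L /TC KC /UD LD KL; apply: CD.
apply: affinely_similar_trans (affinely_similar_sym LD) _.
exact: affinely_similar_trans (affinely_similar_sym KL) KC.
Qed.

Lemma isotropic_attractor_canon (a b : int) (C : set 'cV[R]_(k * 2)) :
  (b = - 2 /\ a = 0) \/ (b = 2 /\ `|a| <= 2) ->
  (forall M d0 d1, generates_2attractor R M d0 d1 -> char_poly M = admissible_poly k a b ->
     affinely_similar (attractor R M [set d0; d1]) C) ->
  exists2 G, isotropic_2attractor G & affinely_similar G C.
Proof.
move=> ab MC; have [M [d0 [d1 [gM iM pM]]]] := exists_isotropic_matrix R k0 ab.
by exists (attractor R M [set d0; d1]); [exists M, d0, d1|exact: MC].
Qed.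

Lemma attractor_canon_parallelepiped M d0 d1 (b : int) : `|b| = 2 ->
  generates_2attractor R M d0 d1 -> char_poly M = admissible_poly k 0 b ->
  affinely_similar (attractor R M [set d0; d1]) (canon k 0 2^-1).
Proof.
move=> b2 gM pM.
exact (attractor_parallelepiped erefl k0 gM pM (@canon_total 0 2^-1) erefl b2
  (@canon_satrec 0 2^-1)).
Qed.

Lemma attractor_canon_dragon M d0 d1 (a : int) : `|a| = 2 ->
  generates_2attractor R M d0 d1 -> char_poly M = admissible_poly k a 2 ->
  affinely_similar (attractor R M [set d0; d1]) (canon k 1 (- 2^-1)).
Proof.
move=> a2 gM pM.
have aE : 1 = a%:~R / 2 :> R \/ 1 = - (a%:~R / 2) :> R.
  have [->|->] : a = 2 \/ a = - 2 by lia.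
    by left; rewrite mulfV ?pnatr_eq0.
  by right; rewrite rmorphN mulNr opprK mulfV ?pnatr_eq0.
exact (attractor_quadratic erefl k0 gM pM (@canon_total 1 (- 2^-1)) erefl aE
  (contractive_dragon R) (@canon_satrec 1 (- 2^-1))).
Qed.

Lemma attractor_canon_bear M d0 d1 (a : int) : `|a| = 1 ->
  generates_2attractor R M d0 d1 -> char_poly M = admissible_poly k a 2 ->
  affinely_similar (attractor R M [set d0; d1]) (canon k 2^-1 (- 2^-1)).
Proof.
move=> a1 gM pM.
have aE : 2^-1 = a%:~R / 2 :> R \/ 2^-1 = - (a%:~R / 2) :> R.
  have [->|->] : a = 1 \/ a = - 1 by lia.
    by left; rewrite mul1r.
  by right; rewrite rmorphN mulNr opprK mul1r.
exact (attractor_quadratic erefl k0 gM pM (@canon_total 2^-1 (- 2^-1)) erefl aE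
  (contractive_bear R) (@canon_satrec 2^-1 (- 2^-1))).
Qed.

End CanonicalTypes.

Theorem theorem4 (R : realType) (k : nat) (hk : (0 < k)%N) :
  (* each type is, up to affine similarity, an isotropic 2-attractor *)
  [/\ is_isotropic_type (@parallelepiped R (k * 2)),
      is_isotropic_type (@product_of_dragons R k)
    & is_isotropic_type (@product_of_bears R k)] /\
  (* the three types are pairwise not affinely similar *)
  [/\ dissimilar_types (@parallelepiped R (k * 2)) (@product_of_dragons R k),
      dissimilar_types (@parallelepiped R (k * 2)) (@product_of_bears R k)
    & dissimilar_types (@product_of_dragons R k) (@product_of_bears R k)] /\
  (* there are no others *)
  (forall G : set 'cV[R]_(k * 2), isotropic_2attractor G ->
     exists2 K : set 'cV[R]_(k * 2),
       [\/ parallelepiped K, product_of_dragons K | product_of_bears K]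
       & affinely_similar G K).
Proof.
split; [split|split; [split|]].
- apply: isotropic_type_of_canon (canon_parallelepiped R hk) (parallelepiped_canon hk) _.
  (* The three types are realised by [X^2k - 2], [X^2k + 2 X^k + 2] and [X^2k + X^k + 2]. *)
  apply: (isotropic_attractor_canon hk (a := 0) (b := - 2)); first by left.
  by move=> M d0 d1; exact: attractor_canon_parallelepiped.
- apply: isotropic_type_of_canon (canon_product_of_dragons R hk)
    (product_of_dragons_canon hk) _.
  apply: (isotropic_attractor_canon hk (a := 2) (b := 2)); first by right.
  by move=> M d0 d1; exact: attractor_canon_dragon.
- apply: isotropic_type_of_canon (canon_product_of_bears R hk)
    (product_of_bears_canon hk) _.
  apply: (isotropic_attractor_canon hk (a := 1) (b := 2)); first by right.
  by move=> M d0 d1; exact: attractor_canon_bear.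
- exact: dissimilar_of_canon (parallelepiped_canon hk) (product_of_dragons_canon hk)
    (canon_dragon_not_parallelepiped hk).
- exact: dissimilar_of_canon (parallelepiped_canon hk) (product_of_bears_canon hk)
    (canon_bear_not_parallelepiped hk).
- exact: dissimilar_of_canon (product_of_dragons_canon hk) (product_of_bears_canon hk)
    (canon_bear_not_dragon hk).
move=> G [M [d0 [d1 [gM [_ eqM] ->]]]].
have [_ detM _] := gM.
have [a [b [pM b2 ab]]] := isotropic_char_poly hk detM eqM.
(* The case [a = 0], with either sign of [b], gives parallelepipeds; with [b = 2], [|a| = 1] gives
   bears and [|a| = 2] dragons. *)
have [a0|[b2' a2]] : a = 0 \/ (b = 2 /\ (`|a| = 1 \/ `|a| = 2)) by lia.
  exists (canon k 0 2^-1); first by apply: Or31; exact: canon_parallelepiped.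
  by rewrite a0 in pM; exact: attractor_canon_parallelepiped pM.
rewrite b2' in pM; case: a2 => a2.
  exists (canon k 2^-1 (- 2^-1)); first by apply: Or33; exact: canon_product_of_bears.
  exact: attractor_canon_bear pM.
exists (canon k 1 (- 2^-1)); first by apply: Or32; exact: canon_product_of_dragons.
exact: attractor_canon_dragon pM.
Qed.
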